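(* Let $(\mathbb{K},[\cdot,\cdot])$ be a Krein space with fundamental symmetry $J$, and let $\mathbb{F}=\{(W_i,v_i):i\in I\}$ be a $J$-fusion frame for $\mathbb{K}$ with optimal $J$-fusion frame bounds $B_-,A_-,A_+,B_+$, and let $M_\pm=\overline{\sum_{i\in I_\pm}W_i}$. Then $$-\frac{1}{\gamma(G_{M_-})}\|{T_{W,v}}_-\|_J^2\le B_-\le A_-\le-\gamma({T_{W,v}}_-)^2\gamma(G_{M_-})^2<0<\gamma({T_{W,v}}_+)^2\gamma(G_{M_+})^2\le A_+\le B_+\le\frac{1}{\gamma(G_{M_+})}\|{T_{W,v}}_+\|_J^2 .$$
   Context: $\langle f,g\rangle_J=[Jf,g]$ is the Hilbert space inner product of $\mathbb{K}$ and $\|\cdot\|_J$ its norm (also used for the operator norm). For a closed subspace $W$, $\pi_W$ is the orthogonal projection onto $W$ with respect to $\langle\cdot,\cdot\rangle_J$. A subspace $W$ is $J$-non-negative if $[f,f]\ge 0$ for all $f\in W$; $J$-negative if $[f,f]<0$ for all nonzero $f\in W$; uniformly $J$-positive (resp. uniformly $J$-negative) if there is $\alpha>0$ with $[f,f]\ge\alpha\|f\|_J^2$ (resp. $-[f,f]\ge\alpha\|f\|_J^2$) for all $f\in W$. Maximality is with respect to inclusion. Families $\{(W_i,v_i):i\in I\}$ consist of closed subspaces $W_i$ of $\mathbb{K}$ with weights $v_i>0$, where each $W_i$ is either $J$-non-negative or $J$-negative. $I_+$ is the set of $i$ with $W_i$ $J$-non-negative, and $I_-$ the set of $i$ with $W_i\neq\{0\}$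 and $W_i$ $J$-negative. The family is Bessel if $\sum_{i}v_i^2\|\pi_{W_i}f\|_J^2\le B\|f\|_J^2$ for some $B<\infty$ and all $f\in\mathbb{K}$. Let $(\sum_{i\in I}\oplus W_i)_{\ell_2}$ be the Hilbert space of families $\{f_i\}$, $f_i\in W_i$, with norm $(\sum\|f_i\|_J^2)^{1/2}<\infty$. The synthesis operator is $T_{W,v}\{f_i\}=\sum_{i\in I}v_if_i$. Let $P_\pm$ be the orthogonal projection of this space onto $(\sum_{i\in I_\pm}\oplus W_i)_{\ell_2}$, and ${T_{W,v}}_\pm=T_{W,v}P_\pm$. The Bessel family is a $J$-fusion frame for $\mathbb{K}$ if the range $R({T_{W,v}}_+)$ is a maximal uniformly $J$-positive subspace and $R({T_{W,v}}_-)$ is a maximal uniformly $J$-negative subspace of $\mathbb{K}$. $J$-fusion frame bounds are constants $-\infty<B_-\le A_-<0<A_+\le B_+<\infty$ with $A_{\pm}[f,f]\le\sum_{i\in I_\pm}v_i^2|[\pi_{W_i}J(f),f]|\le B_\pm[f,f]$ for all $f\in M_\pm$. They are optimal when they are best possible: $A_+$ and $|A_-|$ are the largest, and $B_+$ and $|B_-|$ the smallest, such constants. For a closed subspace $M$, the Gramian operator is $G_M=\pi_MJ|_M:M\to M$. The reduced minimum modulus of a bounded operator $T$ between Hilbert spaces is $\gamma(T)=\inf\{\|Tx\|:x\in N(T)^\perp,\ \|x\|=1\}$, where $N(T)$ is the null space. *)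

(* Defs.v *)
From HB Require Import structures.
From mathcomp Require Import all_boot all_order all_algebra.
From mathcomp Require Import sesquilinear finmap complex.
From mathcomp Require Import all_classical all_reals all_analysis.
From mathcomp.analysis.showcase Require summability.
Set Implicit Arguments.
Unset Strict Implicit.
Unset Printing Implicit Defensive.
Import Order.TTheory GRing.Theory Num.Theory.
Import numFieldNormedType.Exports.
Local Open Scope classical_set_scope.
Local Open Scope complex_scope.
Local Open Scope ring_scope.

(* A Hilbert space is given by a carrier set inside an ambient vector space
   together with an inner product, linear in its first argument. *)
Section HilbertOperators.
Context {R : realType} {U : lmodType R[i]}.
Implicit Types (D M : set U) (ip : U -> U -> R[i]).

Definition ipnorm ip (x : U) : R := Num.sqrt (complex.Re (ip x x)).

Definition orth_proj ip M (x : U) : U :=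
  xget 0 [set y | M y /\ forall z, M z -> ip (x - y) z = 0].

Definition null_space {V : lmodType R[i]} D (T : U -> V) : set U :=
  [set x | D x /\ T x = 0].

Definition orth_compl ip D M : set U :=
  [set x | D x /\ forall y, M y -> ip x y = 0].

(* [inf] and [sup] are real-valued; [inf set0 = 0], which concerns only the
   zero operator. *)
Definition reduced_min_modulus {V : lmodType R[i]} D ip (nrm : V -> R)
    (T : U -> V) : R :=
  inf [set nrm (T x) |
       x in [set x | orth_compl ip D (null_space D T) x /\ ipnorm ip x = 1]].

Definition op_norm {V : lmodType R[i]} D ip (nrm : V -> R) (T : U -> V) : R :=
  sup [set nrm (T x) | x in [set x | D x /\ ipnorm ip x <= 1]].

End HilbertOperators.

Section Krein.
Context {R : realType} {K : completeNormedModType R[i]}.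
Variable form : {hermitian_sym K for @conjc R}.
Variable J : {linear K -> K}.
Implicit Types (W M : set K).

(* [f, f] is a real number since the form is hermitian. *)
Definition qform (f : K) : R := complex.Re (form f f).

Definition J_ip (f g : K) : R[i] := form (J f) g.
Definition J_norm : K -> R := ipnorm J_ip.

(* J = P_+ - P_- for a fundamental decomposition K = K_+ [+] K_-. *)
Definition fundamental_symmetry : Prop :=
  exists Kp Km : set K,
    [/\ submod_closed [in Kp] /\ submod_closed [in Km],
        forall f, exists g h, [/\ Kp g, Km h & f = g + h],
        forall g h, Kp g -> Km h -> form g h = 0,
        (forall g, Kp g -> g != 0 -> 0 < qform g) /\
        (forall h, Km h -> h != 0 -> qform h < 0)
      & (forall g, Kp g -> J g = g) /\ (forall h, Km h -> J h = - h)].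

(* The norm of the complete normed space K is the J-norm, so that
   (K, <.,.>_J) is a Hilbert space, and so are (K_+, [.,.]) and (K_-, -[.,.]);
   [closed] and [closure] refer to this norm. *)
Definition krein_space : Prop :=
  fundamental_symmetry /\ forall f : K, `|f| = (J_norm f)%:C.

Definition J_nonnegative W : Prop := forall f, W f -> 0 <= qform f.

Definition J_negative W : Prop := forall f, W f -> f != 0 -> qform f < 0.

Definition uniformly_J_positive W : Prop :=
  submod_closed [in W] /\
  exists2 a : R, 0 < a & forall f, W f -> a * J_norm f ^+ 2 <= qform f.

Definition uniformly_J_negative W : Prop :=
  submod_closed [in W] /\
  exists2 a : R, 0 < a & forall f, W f -> a * J_norm f ^+ 2 <= - qform f.

Definition maximal_wrt (P : set K -> Prop) W : Prop :=
  P W /\ forall W', P W' -> W `<=` W' -> W' = W.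

Definition J_proj W : K -> K := orth_proj J_ip W.

Definition gramian M (f : K) : K := J_proj M (J f).

(* gamma (G_M : M -> M) *)
Definition gamma_gramian M : R :=
  reduced_min_modulus M J_ip J_norm (gramian M).

Section Family.
Context {I : choiceType}.
Variables (W : I -> set K) (v : I -> R).
Implicit Types (P : set I) (f : I -> K).

Definition weighted_family : Prop :=
  forall i, [/\ submod_closed [in W i], closed (W i), 0 < v i
              & J_nonnegative (W i) \/ J_negative (W i)].

Definition Iplus : set I := [set i | J_nonnegative (W i)].
Definition Iminus : set I := [set i | W i <> [set 0] /\ J_negative (W i)].

Definition bessel : Prop :=
  exists B : R, forall f : K,
    (\esum_(i in [set: I]) (v i ^+ 2 * J_norm (J_proj (W i) f) ^+ 2)%:E
       <= (B * J_norm f ^+ 2)%:E)%E.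

(* (sum_{i in P} (+) W_i)_{l2}, as the families of (sum_{i in I} (+) W_i)_{l2}
   that vanish outside P. *)
Definition ell2 P : set (I -> K) :=
  [set f | [/\ forall i, W i (f i), forall i, ~ P i -> f i = 0
             & (\esum_(i in [set: I]) (J_norm (f i) ^+ 2)%:E < +oo)%E]].

(* Sums over I of vectors and of complex numbers are limits of finite partial
   sums along the finite subsets of I directed by inclusion. *)
Definition ell2_ip f g : R[i] :=
  summability.sum (fun i => J_ip (f i) (g i) : R[i]^o).

Definition synthesis f : K := summability.sum (fun i => (v i)%:C *: f i).

(* T P_+ and T P_- for P := Iplus and P := Iminus *)
Definition synthesis_on P f : K :=
  synthesis (orth_proj ell2_ip (ell2 P) f).

Definition range_synthesis_on P : set K :=
  synthesis_on P @` ell2 [set: I].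

Definition norm_synthesis_on P : R :=
  op_norm (ell2 [set: I]) ell2_ip J_norm (synthesis_on P).

Definition gamma_synthesis_on P : R :=
  reduced_min_modulus (ell2 [set: I]) ell2_ip J_norm (synthesis_on P).

Definition J_fusion_frame : Prop :=
  [/\ weighted_family, bessel,
      maximal_wrt uniformly_J_positive (range_synthesis_on Iplus)
    & maximal_wrt uniformly_J_negative (range_synthesis_on Iminus)].

(* Closure of the algebraic sum of the W_i, i in P. *)
Definition closed_sum P : set K :=
  closure [set x | exists (A : {fset I}) (g : I -> K),
    (forall i, i \in A -> P i /\ W i (g i)) /\ x = \sum_(i <- A) g i].

Definition Mplus : set K := closed_sum Iplus.
Definition Mminus : set K := closed_sum Iminus.

Definition frame_sum P (f : K) : \bar R :=
  (\esum_(i in P) (v i ^+ 2 * Normc.normc (form (J_proj (W i) (J f)) f))%:E)%E.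

Definition J_frame_bounds (Bm Am Ap Bp : R) : Prop :=
  [/\ Bm <= Am, Am < 0, 0 < Ap & Ap <= Bp] /\
  (forall f : K, Mplus f -> ((Ap * qform f)%:E <= frame_sum Iplus f)%E /\
                        (frame_sum Iplus f <= (Bp * qform f)%:E)%E) /\
  (forall f : K, Mminus f -> ((Am * qform f)%:E <= frame_sum Iminus f)%E /\
                         (frame_sum Iminus f <= (Bm * qform f)%:E)%E).

Definition optimal_J_frame_bounds (Bm Am Ap Bp : R) : Prop :=
  J_frame_bounds Bm Am Ap Bp /\
  forall Bm' Am' Ap' Bp', J_frame_bounds Bm' Am' Ap' Bp' ->
    [/\ Ap' <= Ap, `|Am'| <= `|Am|, Bp <= Bp' & `|Bm| <= `|Bm'|].

End Family.
End Krein.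

(* Main.v *)
Require Import Defs.
From mathcomp Require Import all_boot all_order all_algebra.
From mathcomp Require Import sesquilinear finmap complex.
From mathcomp Require Import all_classical all_reals all_analysis.
From mathcomp Require Import ring lra.
From mathcomp.analysis.showcase Require summability.
Set Implicit Arguments.
Unset Strict Implicit.
Unset Printing Implicit Defensive.
Import Order.TTheory GRing.Theory Num.Theory.
Import numFieldNormedType.Exports.
Local Open Scope classical_set_scope.
Local Open Scope complex_scope.
Local Open Scope ring_scope.

(* Write [T] for one of the two synthesis operators, [M] for the corresponding
   closed sum and [S = T T^*].  Maximality makes [R(T)] closed, so [R(T) = M].
   For [f] in [M] the frame sum is [|T^* J f|^2 = |T^* G f|^2 = <S G f, G f>],
   since [R(T)] is contained in [M].  Now [|T^* y| <= |T| |y|] and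
   [|G f|^2 <= |[f, f]|] (Cauchy-Schwarz for the definite form on [M]) give the
   upper bound, as [gamma(G) <= 1]; [gamma(T) |y| <= |T^* y|] on [M],
   [gamma(G) |f| <= |G f|] and [|[f, f]| <= |f|^2] give the lower one.
   That [gamma(T) > 0] needs no open mapping theorem: the given lower frame
   bound makes [S] coercive on [M], hence onto, and then
   [N(T)^perp = T^*(M)].  Projections and the surjectivity of [G] and [S] all
   come from one symmetric Lax-Milgram lemma.  Hilbert space estimates are done
   with the real bilinear form [Re <., .>]. *)

(** * Symmetric real forms and Hilbert products *)

(** The given optimal bounds enter twice, without circularity. As merely admissible constants they
    make [S] coercive, which only yields that the claimed constants are positive; these are then
    shown to be admissible themselves, and optimality is used by comparison. Optimality compares
    whole quadruples, so it also rules out [M = 0], where every constant of the right sign would be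
    admissible; this matters because for [M = 0] the infimum behind [gamma] runs over an empty set
    and takes the default value 0. Both signs are handled at once by a real [e] with [e * e = 1] for
    which [e [., .]] is positive on [M]. Projections and infinite sums are total functions given by
    a choice or a limit, so existence and convergence have to be proved before anything can be
    computed with them. *)

Section Submodule.
Context {R : realType} {U : lmodType R[i]} (M : set U).
Hypothesis Msub : submod_closed [in M].

Lemma submod0 : M 0.
Proof. by case: Msub => /[!in_setE]. Qed.

Lemma submodD x y : M x -> M y -> M (x + y).
Proof.
by case: Msub => _ /(_ 1 x y); rewrite !in_setE scale1r.
Qed.

Lemma submodZ (a : R[i]) x : M x -> M (a *: x).
Proof.
case: Msub => _ /(_ a x 0); rewrite !in_setE addr0 => H Mx.
by apply: H => //; exact: submod0.
Qed.

Lemma submodN x : M x -> M (- x).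
Proof. by rewrite -scaleN1r; exact: submodZ. Qed.

Lemma submodB x y : M x -> M y -> M (x - y).
Proof. by move=> Mx My; apply: submodD => //; exact: submodN. Qed.

End Submodule.

Section SymForm.
Context {R : realType} {U : lmodType R[i]}.
Implicit Types (x y z : U) (t : R) (r : U -> U -> R).

(** Linearity over real scalars only, so that [Re <., .>], [e * Re [., .]] and [Re <S ., .>] are all
    instances and share one Cauchy-Schwarz inequality and one Lax-Milgram lemma. *)
Definition sym_form r : Prop :=
  [/\ forall x y z, r (x + y) z = r x z + r y z,
      forall t x y, r (t%:C *: x) y = t * r x y
    & forall x y, r x y = r y x].

Variable r : U -> U -> R.
Hypothesis sr : sym_form r.

Lemma sfDl x y z : r (x + y) z = r x z + r y z. Proof. by case: sr. Qed.
Lemma sfZl t x y : r (t%:C *: x) y = t * r x y. Proof. by case: sr. Qed.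
Lemma sfC x y : r x y = r y x. Proof. by case: sr. Qed.
Lemma sfDr x y z : r z (x + y) = r z x + r z y.
Proof. by rewrite sfC sfDl !(sfC _ z). Qed.
Lemma sfZr t x y : r x (t%:C *: y) = t * r x y.
Proof. by rewrite sfC sfZl sfC. Qed.
Lemma sf0l x : r 0 x = 0.
Proof. by have := sfZl 0 0 x; rewrite mul0r scaler0. Qed.
Lemma sfNl x y : r (- x) y = - r x y.
Proof. by apply/eqP; rewrite -subr_eq0 opprK -sfDl addNr sf0l. Qed.
Lemma sfNr x y : r x (- y) = - r x y. Proof. by rewrite sfC sfNl sfC. Qed.
Lemma sfBl x y z : r (x - y) z = r x z - r y z.
Proof. by rewrite sfDl sfNl. Qed.
Definition sfE := (sfDl, sfDr, sfNl, sfNr, sfZl, sfZr).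

Lemma sf_suml (T : Type) (s : seq T) (F : T -> U) y :
  r (\sum_(i <- s) F i) y = \sum_(i <- s) r (F i) y.
Proof.
elim: s => [|i s IH]; first by rewrite !big_nil sf0l.
by rewrite !big_cons sfDl IH.
Qed.

Lemma cauchy_schwarz (M : set U) x y : submod_closed [in M] ->
  (forall z, M z -> 0 <= r z z) -> M x -> M y ->
  r x y ^+ 2 <= r x x * r y y.
Proof.
move=> Msub r0 Mx My.
have Q (s t : R) : 0 <= s * s * r x x + 2 * s * t * r x y + t * t * r y y.
  suff : 0 <= r (s%:C *: x + t%:C *: y) (s%:C *: x + t%:C *: y).
    by rewrite !sfE (sfC y x); nra.
  by apply: r0; apply: submodD => //; apply: submodZ.
have := r0 _ My; rewrite le_eqVlt => /predU1P[ry0|ry0]; last first.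
  have := Q (r y y) (- r x y).
  rewrite (_ : _ + _ = r y y * (r x x * r y y - r x y ^+ 2)); last by ring.
  by rewrite pmulr_rge0// subr_ge0.
(* With [r y y = 0] these coefficients give [- (2 + r x x) * r x y ^+ 2 >= 0], hence [r x y = 0]. *)
have := Q (r x y) (- (1 + r x x)); rewrite -ry0.
have := r0 _ Mx; move: (r x y) (r x x) => a b b0; nra.
Qed.

(** Symmetry moves [S] to the other argument, where linearity of [r] applies; linearity of [T T^*]
    thus never has to be proved separately. *)
Lemma sym_op_form (S : U -> U) : (forall y z, r (S y) z = r (S z) y) ->
  sym_form (fun y z => r (S y) z).
Proof.
move=> SC; split=> [x y z|t x y|x y]; last exact: SC.
- by rewrite SC sfDr !(SC z).
- by rewrite SC sfZr SC.
Qed.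

End SymForm.

Lemma normc_ge0 (R : rcfType) (a : R[i]) : 0 <= Normc.normc a.
Proof. by case: a => a b; exact: sqrtr_ge0. Qed.

Lemma normc_real (R : rcfType) (t : R) : Normc.normc t%:C = `|t|.
Proof. by rewrite /= expr0n addr0 sqrtr_sqr. Qed.

(** * Norm, topology and real part of a Hilbert product *)

Section HilbertProduct.
Context {R : realType} {K : completeNormedModType R[i]}.
Implicit Types (ip : K -> K -> R[i]) (x y z : K).

Definition hilbert_product ip : Prop :=
  [/\ forall a x y z, ip (a *: x + y) z = a * ip x z + ip y z,
      forall x y, ip x y = (ip y x)^*,
      forall x, 0 <= complex.Re (ip x x)
    & forall x, `|x| = (ipnorm ip x)%:C].

Variable ip : K -> K -> R[i].
Hypothesis hip : hilbert_product ip.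
Let r x y := complex.Re (ip x y).
Let N := ipnorm ip.

Lemma hilbert_sym_form : sym_form r.
Proof.
case: hip => ipl ipC _ _.
have ip0 z : ip 0 z = 0.
  by have := ipl (-1) 0 0 z; rewrite scaler0 addr0 mulN1r addNr.
split=> [x y z|t x y|x y]; rewrite /r.
- by have := ipl 1 x y z; rewrite scale1r mul1r => ->; case: (ip x z) (ip y z) => ? ? [].
- have := ipl t%:C x 0 y; rewrite addr0 ip0 addr0 => ->.
  by case: (ip x y) => a b /=; rewrite mul0r subr0.
- by rewrite ipC; case: (ip y x).
Qed.

Local Notation sr := hilbert_sym_form.

Lemma ip_Im x y : complex.Im (ip x y) = r x ('i *: y).
Proof.
case: hip => ipl ipC _ _.
have ip0 z : ip 0 z = 0.
  by have := ipl (-1) 0 0 z; rewrite scaler0 addr0 mulN1r addNr.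
rewrite /r (ipC x ('i *: y)).
have := ipl 'i y 0 x; rewrite addr0 ip0 addr0 => ->.
by rewrite (ipC y x); case: (ip x y) => a b /=; ring.
Qed.

(** A complex subspace contains ['i *: y] along with [y], and the real part at ['i *: y] is the
    imaginary part at [y]. This is what allows working with [r] throughout. *)
Lemma ip_eq0 (M : set K) x : submod_closed [in M] ->
  (forall y, M y -> r x y = 0) -> forall y, M y -> ip x y = 0.
Proof.
move=> Msub rM y My; apply/eqP; rewrite eq_complex /= -/(r x y) rM// ip_Im.
by rewrite rM ?eqxx//; exact: submodZ.
Qed.

Lemma ipnorm_ge0 x : 0 <= N x. Proof. exact: sqrtr_ge0. Qed.

Lemma ipnorm_sqr x : N x ^+ 2 = r x x.
Proof. by rewrite sqr_sqrtr//; case: hip. Qed.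

Lemma ipnorm_eq0 x : N x = 0 -> x = 0.
Proof.
case: hip => _ _ _ nE Nx; apply/eqP; rewrite -normr_eq0 nE.
by rewrite -/(N x) Nx.
Qed.

Lemma ipnorm0 : N 0 = 0.
Proof. by apply/eqP; rewrite -sqrf_eq0 ipnorm_sqr (sf0l sr). Qed.

Lemma ip_real_def x : r x x = 0 -> x = 0.
Proof.
by move=> rx; apply: ipnorm_eq0; apply/eqP; rewrite -sqrf_eq0 ipnorm_sqr rx.
Qed.

Lemma ipnormZC (a : R[i]) x : N (a *: x) = Normc.normc a * N x.
Proof.
case: hip => _ _ _ nE; apply: complexI.
by rewrite -/(N _) -[LHS]nE normrZ nE rmorphM.
Qed.

Lemma ipnormZ (t : R) x : N (t%:C *: x) = `|t| * N x.
Proof.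
apply/eqP; rewrite -(@eqrXn2 _ 2)// ?mulr_ge0 ?ipnorm_ge0//.
by rewrite exprMn !ipnorm_sqr !(sfE sr) real_normK ?num_real// mulrA.
Qed.

Lemma ipnormN x : N (- x) = N x.
Proof. by rewrite /N /ipnorm -![complex.Re _]/(r _ _) !(sfE sr) opprK. Qed.

Lemma submod_closedT : submod_closed [in [set: K]].
Proof. by split=> [|a x y]; rewrite ?in_setE. Qed.

Lemma r_le_ipnorm x y : `|r x y| <= N x * N y.
Proof.
rewrite -(@ler_pXn2r _ 2)// ?nnegrE ?mulr_ge0 ?ipnorm_ge0//.
rewrite real_normK ?num_real// exprMn !ipnorm_sqr.
apply: (cauchy_schwarz sr submod_closedT) => // z _.
by rewrite -ipnorm_sqr sqr_ge0.
Qed.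

Lemma ler_ipnormD x y : N (x + y) <= N x + N y.
Proof.
rewrite -(@ler_pXn2r _ 2)// ?nnegrE ?addr_ge0 ?ipnorm_ge0//.
rewrite ipnorm_sqr !(sfE sr) (sfC sr y x).
have := r_le_ipnorm x y; rewrite ler_norml => /andP[_].
by rewrite -!ipnorm_sqr; nra.
Qed.

Lemma ball_ipnorm x (e : R) : ball x e%:C = [set y | N (x - y) < e].
Proof.
case: hip => _ _ _ nE; rewrite -ball_normE; apply/seteqP; split=> y /=;
by rewrite nE ltcR.
Qed.

(** Radii of balls in [K] are elements of [R[i]]; a positive one is real, so real radii suffice. *)
Lemma nbhs_ipnorm x (A : set K) :
  nbhs x A <-> exists2 e : R, 0 < e & [set y | N (x - y) < e] `<=` A.
Proof.
split=> [/nbhs_ballP[e /= e0 eA]|[e e0 eA]].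
  have eE : e = (complex.Re e)%:C by rewrite RRe_real// gtr0_real.
  exists (complex.Re e); last by rewrite -ball_ipnorm -eE.
  by move: e0; rewrite eE ltcR.
by apply/nbhs_ballP; exists e%:C; rewrite /= ?ltcR// ball_ipnorm.
Qed.

Lemma closure_ipnorm (A : set K) x :
  closure A x <-> forall e : R, 0 < e -> exists2 y, A y & N (x - y) < e.
Proof.
split=> [cA e e0|H B /nbhs_ipnorm[e e0 eB]].
  have [|y [Ay xy]] := cA [set y | N (x - y) < e].
    by apply/nbhs_ipnorm; exists e.
  by exists y.
by have [y Ay xy] := H _ e0; exists y; split=> //; apply: eB.
Qed.

Lemma closure_submod (A : set K) : submod_closed [in A] ->
  submod_closed [in closure A].
Proof.
move=> Asub; split=> [|a x y]; rewrite !in_setE.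
  by apply: subset_closure; exact: submod0.
move=> /closure_ipnorm cx /closure_ipnorm cy; apply/closure_ipnorm => e e0.
(* The summand 1 covers [a = 0] in the division of the radius. *)
have a0 : 0 < Normc.normc a + 1 by rewrite ltr_wpDl// normc_ge0.
have [x' Ax xx'] := cx _ (divr_gt0 (divr_gt0 e0 (ltr0n _ 2)) a0).
have [y' Ay yy'] := cy _ (divr_gt0 e0 (ltr0n _ 2)).
exists (a *: x' + y').
  by apply: submodD => //; exact: submodZ.
have -> : a *: x + y - (a *: x' + y') = a *: (x - x') + (y - y').
  by rewrite scalerBr opprD addrACA.
apply: le_lt_trans (ler_ipnormD _ _) _; rewrite ipnormZC.
move: xx'; rewrite ltr_pdivlMr// => xx'; have := normc_ge0 a.
by have := ipnorm_ge0 (x - x'); nra.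
Qed.

Lemma cvg_ipnorm (T : Type) (F : set_system T) {FF : Filter F} (f : T -> K) x :
  (f @ F --> x) <-> forall e : R, 0 < e -> \forall t \near F, N (x - f t) < e.
Proof.
split=> [fx e e0|H].
  by apply: (fx [set y | N (x - y) < e]); apply/nbhs_ipnorm; exists e.
by move=> B /nbhs_ipnorm[e e0 eB]; apply: filterS (H _ e0) => t; exact: eB.
Qed.

Lemma complete_ipnorm (T : Type) (F : set_system T) {FF : ProperFilter F}
    (f : T -> K) :
  (forall e : R, 0 < e -> exists x, \forall t \near F, N (x - f t) < e) ->
  cvg (f @ F).
Proof.
move=> H; apply: cauchy_cvg; apply: cauchy_exP => e e0.
have eE : e = (complex.Re e)%:C by rewrite RRe_real// gtr0_real.
have [|x Fx] := H (complex.Re e); first by move: e0; rewrite eE ltcR.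
by exists x; rewrite eE ball_ipnorm.
Qed.

(** By symmetry the difference of the two sides is orthogonal to every vector, in particular to
    itself. *)
Lemma sym_opZ (S : K -> K) (t : R) y : (forall y z, r (S y) z = r (S z) y) ->
  S (t%:C *: y) = t%:C *: S y.
Proof.
move=> SC; apply/eqP; rewrite -subr_eq0; apply/eqP/ip_real_def.
set z := _ - _; rewrite {1}/z (sfBl sr) (sfZl sr).
by rewrite (sfZl (sym_op_form sr SC)) subrr.
Qed.

End HilbertProduct.

(** * A symmetric Lax-Milgram lemma *)

Section LaxMilgram.
Context {R : realType} {K : completeNormedModType R[i]}.
Variable ip : K -> K -> R[i].
Hypothesis hip : hilbert_product ip.
Let r x y := complex.Re (ip x y).
Let N := ipnorm ip.
Variables (M : set K) (b : K -> K -> R) (c C : R).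
Hypotheses (Msub : submod_closed [in M]) (Mclosed : closed M).
Hypotheses (sb : sym_form b) (c0 : 0 < c) (C0 : 0 <= C).
Hypothesis coercive : forall f, M f -> c * N f ^+ 2 <= b f f.
Hypothesis bounded : forall f g, `|b f g| <= C * (N f * N g).

(* The solution is the minimiser over [M] of [f |-> b f f - 2 r y f]; the
   parallelogram identity makes minimising sequences Cauchy. *)
Lemma sym_lax_milgram y : exists2 f, M f & forall g, M g -> b f g = r y g.
Proof.
have sr := hilbert_sym_form hip; rewrite -/r in sr.
have N0 f : 0 <= N f by exact: ipnorm_ge0.
have rN f g : `|r f g| <= N f * N g := r_le_ipnorm hip f g.
pose phi f := b f f - 2 * r y f.
(* Completing the square: [c u^2 - 2 w u >= - w^2 / c] with [u = |f|] and [w = |y|]. *)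
have phi_lb f : M f -> - (N y ^+ 2 / c) <= phi f.
  move=> Mf; have := coercive Mf; have := rN y f.
  rewrite ler_norml => /andP[_]; rewrite /phi -mulNr ler_pdivrMr//.
  have := N0 f; move: (N f) (N y) (r y f) (b f f) => u w s v u0 su uv.
  have : 0 <= (c * u - w) ^+ 2 by exact: sqr_ge0.
  have := ler_wpM2l (ltW c0) su; have := ler_wpM2l (ltW c0) uv.
  rewrite sqrrB; lra.
pose E := [set phi f | f in M].
have Einf : has_inf E.
  split; first by exists (phi 0); exists 0 => //; exact: submod0.
  by exists (- (N y ^+ 2 / c)) => _ [f Mf <-]; exact: phi_lb.
have infE f : M f -> inf E <= phi f.
  by move=> Mf; apply: ge_inf; [case: Einf|exists f].
have [u uP] : {u : nat -> K & forall n, M (u n) /\ phi (u n) < inf E + n.+1%:R^-1}.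
  apply: (boolp.choice (P := fun n f => M f /\ phi f < inf E + n.+1%:R^-1)) => n.
  have n0 : 0 < n.+1%:R^-1 :> R by rewrite invr_gt0.
  have [_ [f Mf <-] fE] := inf_adherent n0 Einf.
  by exists f.
(* [b (f - g) (f - g) = 2 phi f + 2 phi g - 4 phi ((f + g) / 2)], and [phi] at the midpoint is at
   least [inf E]. *)
have par d f g : M f -> M g -> phi f < inf E + d -> phi g < inf E + d ->
    c * N (f - g) ^+ 2 <= 4 * d.
  move=> Mf Mg fd gd; have := coercive (submodB Msub Mf Mg).
  have := infE _ (submodZ Msub (2^-1 : R)%:C (submodD Msub Mf Mg)).
  move: fd gd; rewrite /phi !(sfE sb) !(sfE sr) (sfC sb g f).
  nra.
have small d : 0 < d -> \forall n \near \oo, phi (u n) < inf E + d.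
  move=> d0; near=> n; apply: lt_trans (proj2 (uP n)) _; rewrite ltrD2l.
  by near: n; exact: (near_infty_natSinv_lt (PosNum d0)).
have /cvg_ex[l /(cvg_ipnorm hip) ul] : cvg (u @ \oo).
  apply: (complete_ipnorm hip) => e e0.
  have d0 : 0 < c * e ^+ 2 / 8 by rewrite divr_gt0 ?mulr_gt0 ?exprn_gt0.
  have [n _ Hn] := small _ d0.
  exists (u n); near=> m.
  have nm : (n <= m)%N by near: m; exists n.
  have := par _ _ _ (proj1 (uP n)) (proj1 (uP m)) (Hn n (leqnn n)) (Hn m nm).
  rewrite -/(N _); have := N0 (u n - u m); move: (N _) => t t0 H.
  rewrite -(@ltr_pXn2r _ 2)// ?nnegrE//; last exact: ltW.
  have : c * t ^+ 2 < c * e ^+ 2 by nra.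
  by rewrite ltr_pM2l.
have Ml : M l.
  apply: Mclosed; apply/(closure_ipnorm hip) => e e0.
  by have [n _ /(_ n (leqnn n)) ?] := ul _ e0; exists (u n); case: (uP n).
have phil : phi l <= inf E.
  apply/ler_addgt0Pr => e e0.
  (* [D] bounds [|phi l - phi f| / |l - f|] for [f] within distance 1 of [l]. *)
  pose D := C * (2 * N l + 1) + 2 * N y.
  have D0 : 0 <= D by rewrite /D addr_ge0 ?mulr_ge0 ?addr_ge0 ?mulr_ge0.
  have D1 : 0 < D + 1 by lra.
  have e2 : 0 < Num.min 1 (e / 2 / (D + 1)).
    by rewrite lt_min ltr01/= !divr_gt0.
  have e3 : 0 < e / 2 by rewrite divr_gt0.
  have : \forall n \near \oo,
      N (l - u n) < Num.min 1 (e / 2 / (D + 1)) /\ phi (u n) < inf E + e / 2.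
    by near=> n; split; near: n; [exact: ul|exact: small].
  move=> [n _ /(_ n (leqnn n))[]]; rewrite lt_min => /andP[].
  set f := u n; set h := l - f => h1; rewrite ltr_pdivlMr// => hD fE.
  have -> : phi l = phi f + (b h l + b f h - 2 * r y h).
    by rewrite /phi /h !(sfE sb) !(sfE sr) (sfC sb f l); ring.
  have Nf : N f <= N l + N h.
    have -> : f = l + - h by rewrite /h opprB addrC subrK.
    by have := ler_ipnormD hip l (- h); rewrite (ipnormN hip).
  have := bounded h l; rewrite ler_norml => /andP[_ B1].
  have := bounded f h; rewrite ler_norml => /andP[_ B2].
  have := rN y h; rewrite ler_norml => /andP[B3 _].
  have B4 : C * (N f * N h) <= C * ((N l + N h) * N h).
    by rewrite ler_wpM2l// ler_wpM2r.
  have B5 : C * (N h * N h) <= C * (1 * N h).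
    by rewrite ler_wpM2l// ler_wpM2r// ltW.
  have : N h * D <= e / 2 by have := N0 h; lra.
  rewrite /D; lra.
exists l => // g Mg.
have bg : 0 <= b g g by apply: le_trans (coercive Mg); rewrite mulr_ge0 ?sqr_ge0 ?ltW.
(* [2 * D] is the derivative of [phi] at [l] along [g]. The step [t] strictly decreases [phi] unless
   [D = 0]; the 1 in its denominator covers [b g g = 0]. *)
pose D := b l g - r y g; pose t := - D / (b g g + 1).
have B1 : 0 < b g g + 1 by lra.
have : phi l <= phi (l + t%:C *: g).
  by apply: le_trans phil _; apply: infE; apply: submodD => //; exact: submodZ.
have -> : phi (l + t%:C *: g) = phi l + t * (t * b g g + 2 * D).
  by rewrite /phi /D !(sfE sb) !(sfE sr) (sfC sb g l); ring.
rewrite lerDl.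
have -> : t * (t * b g g + 2 * D) = - (D ^+ 2 * (b g g + 2)) / (b g g + 1) ^+ 2.
  by rewrite /t; field; rewrite gt_eqF.
rewrite pmulr_lge0 ?invr_gt0 ?exprn_gt0// oppr_ge0 => H.
have : D ^+ 2 = 0.
  apply/eqP; rewrite eq_le sqr_ge0 andbT.
  by rewrite -(@pmulr_lle0 _ (b g g + 2))//; lra.
by move/eqP; rewrite sqrf_eq0 subr_eq0 => /eqP.
Unshelve. all: by end_near.
Qed.

End LaxMilgram.

(** * Orthogonal projections and the fundamental symmetry *)

Section Projection.
Context {R : realType} {K : completeNormedModType R[i]}.
Variable ip : K -> K -> R[i].
Hypothesis hip : hilbert_product ip.
Let r x y := complex.Re (ip x y).
Let N := ipnorm ip.
Let sr : sym_form r := hilbert_sym_form hip.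
Variable M : set K.
Hypotheses (Msub : submod_closed [in M]) (Mclosed : closed M).
Local Notation P := (orth_proj ip M).

(** Riesz: Lax-Milgram with [b = r] and [c = C = 1]. The solution shows that [xget] does not fall
    back on its default. *)
Lemma orth_projP x : M (P x) /\ forall z, M z -> ip (x - P x) z = 0.
Proof.
apply: (xgetPex 0 (P := [set y | M y /\ forall z, M z -> ip (x - y) z = 0])).
have rc f : M f -> 1 * N f ^+ 2 <= r f f by rewrite mul1r (ipnorm_sqr hip).
have rb f g : `|r f g| <= 1 * (N f * N g) by rewrite mul1r; exact: r_le_ipnorm.
have [y My yx] := sym_lax_milgram hip Msub Mclosed sr ltr01 ler01 rc rb x.
exists y; split=> //; apply: (ip_eq0 hip Msub) => z Mz.
by rewrite -[LHS]/(r _ _) (sfBl sr) yx ?subrr.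
Qed.

Lemma orth_proj_mem x : M (P x). Proof. by case: (orth_projP x). Qed.

Lemma orth_proj_Re x z : M z -> r (P x) z = r x z.
Proof.
move=> Mz; apply/eqP; rewrite eq_sym -subr_eq0 -(sfBl sr).
by rewrite /r (proj2 (orth_projP x)).
Qed.

(** Real parts are enough: [P x - y] lies in [M] and can be tested against itself. *)
Lemma orth_proj_unique x y : M y -> (forall z, M z -> r y z = r x z) -> P x = y.
Proof.
move=> My yx; apply/eqP; rewrite -subr_eq0; apply/eqP.
have Mz : M (P x - y) by apply: submodB => //; exact: orth_proj_mem.
by apply: (ip_real_def hip); rewrite -[LHS]/(r _ _) (sfBl sr) orth_proj_Re// yx ?subrr.
Qed.

Lemma orth_projZ (t : R) x : P (t%:C *: x) = t%:C *: P x.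
Proof.
apply: orth_proj_unique => [|z Mz]; first by apply: submodZ => //; exact: orth_proj_mem.
by rewrite !(sfZl sr) !orth_proj_Re.
Qed.

Lemma orth_proj_idem x : r (P x) (P x) = r x (P x).
Proof. by rewrite orth_proj_Re//; exact: orth_proj_mem. Qed.

Lemma orth_proj_norm x : N (P x) <= N x.
Proof.
have := r_le_ipnorm hip x (P x); rewrite -/(r _ _) -orth_proj_idem.
rewrite -[r (P x) (P x)](ipnorm_sqr hip) -/(N _) ger0_norm ?sqr_ge0// expr2.
have := ipnorm_ge0 ip (P x); rewrite -/(N _) le_eqVlt => /predU1P[<- _|P0].
  exact: ipnorm_ge0.
by rewrite ler_pM2r.
Qed.

End Projection.

(** * The Hilbert product of a Krein space *)

Section KreinBasics.
Context {R : realType} {K : completeNormedModType R[i]}.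
Variable form : {hermitian_sym K for @conjc R}.
Variable J : {linear K -> K}.
Hypothesis krein : krein_space form J.
Local Notation ip := (J_ip form J).
Local Notation q := (qform form).

Lemma formC x y : form x y = (form y x)^*.
Proof. by rewrite hermC expr0 mul1r. Qed.

Lemma J_involution : [/\ forall f, J (J f) = f, forall f g, form (J f) g = form f (J g)
  & forall f, 0 <= complex.Re (form (J f) f)].
Proof.
case: krein => -[Kp [Km [[Kps Kms] dec orth [pos neg] [Jp Jm]]]] _.
have orth' g h : Kp g -> Km h -> form h g = 0.
  by move=> Kg Kh; rewrite formC orth; first exact: conjc0. 
split=> [f|f f'|f].
- have [g [h [Kg Kh ->]]] := dec f.
  by rewrite linearD (Jp g)// (Jm h)// linearB (Jp g)// (Jm h)// opprK.
- have [g [h [Kg Kh ->]]] := dec f; have [g' [h' [Kg' Kh' ->]]] := dec f'.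
  rewrite ![J (_ + _)]linearD (Jp g)// (Jm h)// (Jp g')// (Jm h')//.
  rewrite !linearDl !linearDr !linearNl/= !linearNr/=.
  by rewrite (orth g h')// (orth' g' h)// !oppr0.
- have [g [h [Kg Kh ->]]] := dec f.
  rewrite [J (_ + _)]linearD (Jp g)// (Jm h)// linearDl !linearDr !linearNl/=.
  rewrite (orth g h)// (orth' g h)// !oppr0 !addr0 add0r raddfB/=.
  have P : 0 <= q g.
    have [->|g0] := eqVneq g 0; last by apply/ltW/pos.
    by rewrite /qform linear0l.
  have M : q h <= 0.
    have [->|h0] := eqVneq h 0; last by apply/ltW/neg.
    by rewrite /qform linear0l.
  by rewrite subr_ge0; exact: le_trans M P.
Qed.

Lemma hilbert_J_ip : hilbert_product ip.
Proof.
have [JJ Jsym J0] := J_involution; split=> //.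
- by move=> a x y z; rewrite /J_ip linearP linearPl.
- by move=> x y; rewrite /J_ip Jsym formC.
- by case: krein.
Qed.

Lemma form_J_ip f g : form f g = ip (J f) g.
Proof. by have [JJ _ _] := J_involution; rewrite /J_ip JJ. Qed.

Lemma J_norm_J f : J_norm form J (J f) = J_norm form J f.
Proof.
have [JJ Jsym _] := J_involution.
by rewrite /J_norm /ipnorm /J_ip JJ -Jsym.
Qed.

(** The factor [e] is the sign that makes the indefinite form positive on the subspace at hand. *)
Lemma sym_form_form (e : R) : sym_form (fun f g => e * complex.Re (form f g)).
Proof.
split=> [x y z|t x y|x y].
- by rewrite linearDl/= raddfD mulrDr.
- by rewrite linearZl_LR/= mulrCA; case: (form x y) => a b /=; rewrite mul0r subr0.
- by rewrite formC; case: (form y x).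
Qed.

Lemma form_bound f g :
  `|complex.Re (form f g)| <= J_norm form J f * J_norm form J g.
Proof. by rewrite form_J_ip -(J_norm_J f); exact: (r_le_ipnorm hilbert_J_ip). Qed.

End KreinBasics.

(** * Unconditional sums *)

Section FiniteSums.
Context {I : choiceType}.

Lemma big_fset_subset (V : nmodType) (A0 A : {fset I}) (F : I -> V) :
  (A0 `<=` A)%fset ->
  \sum_(i <- A) F i = \sum_(i <- A0) F i + \sum_(i <- (A `\` A0)%fset) F i.
Proof.
move=> sA; rewrite (big_fsetID _ (mem A0) A) /=; congr (_ + _).
  apply: eq_fbigl => i; rewrite !inE/=.
  by apply/andP/idP => [[]//|iA]; split=> //; exact: (fsubsetP sA).
by apply: eq_fbigl => i; rewrite !inE/= andbC.
Qed.

Lemma ler_big_fset_subset (R : realDomainType) (A0 A : {fset I}) (a : I -> R) :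
  (forall i, 0 <= a i) -> (A0 `<=` A)%fset ->
  \sum_(i <- A0) a i <= \sum_(i <- A) a i.
Proof.
by move=> a0 /(big_fset_subset a) ->; rewrite lerDl sumr_ge0.
Qed.

Local Open Scope ereal_scope.
Lemma esum_setT_le (R : realType) (a : I -> R) (C : R) :
  \esum_(i in [set: I]) (a i)%:E <= C%:E <->
  forall A : {fset I}, (\sum_(i <- A) a i <= C)%R.
Proof.
split=> [aC A|aC].
  rewrite -lee_fin -sumEFin; apply: le_trans aC; apply: esum_ge.
  exists [set` A]; first by split=> //; exact: finite_fset.
  by rewrite fsbig_finite ?set_fsetK//; exact: finite_fset.
apply: ge_ereal_sup => _ [X [finX _] <-].
by rewrite fsbig_finite//= sumEFin lee_fin.
Qed.

Lemma esum_setT_adherent (R : realType) (a : I -> R) (e : R) :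
  (0 < e)%R -> \esum_(i in [set: I]) (a i)%:E < +oo ->
  (forall i, 0 <= a i)%R ->
  exists A : {fset I},
    (fine (\esum_(i in [set: I]) (a i)%:E) - e < \sum_(i <- A) a i)%R.
Proof.
move=> e0 aoo a0.
have fin : \esum_(i in [set: I]) (a i)%:E \is a fin_num.
  by rewrite ge0_fin_numE// esum_ge0// => i _; rewrite lee_fin.
have [_ [X [finX _] <-]] := ub_ereal_sup_adherent e0 fin.
rewrite fsbig_finite//= sumEFin -/(esum _ _) => H.
exists (fset_set X); rewrite -lte_fin EFinB fineK//.
Qed.

End FiniteSums.

Section Summation.
Context {R : realType} {I : choiceType}.

(** Actual convergence of the net of partial sums; [summability.sum] is the bare limit, which has a
    value even for a divergent net. *)
Definition has_sum {V : normedModType R[i]} (x : I -> V) (l : V) : Prop :=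
  summability.partial_sum x @ summability.totally --> l.

Context {V : normedModType R[i]}.
Implicit Types (x y : I -> V) (l m : V).

Lemma has_sum_sum x l : has_sum x l -> summability.sum x = l.
Proof.
have := @summability.totally_filter I => FF xl.
by apply: cvg_lim => //; exact: norm_hausdorff.
Qed.

Lemma partial_sumE x A : summability.partial_sum x A = \sum_(i <- A) x i.
Proof. by rewrite /summability.partial_sum big_seq_fsetE. Qed.

Lemma has_sumP x l : has_sum x l <->
  forall e : R, 0 < e -> exists A0 : {fset I},
    forall A, (A0 `<=` A)%fset -> `|l - \sum_(i <- A) x i| < e%:C.
Proof.
split=> [xl e e0|H].
  have /xl[A0 _ HA] : nbhs l (ball l e%:C) by apply: nbhsx_ballx; rewrite /= ltcR.
  by exists A0 => A /HA; rewrite /= -ball_normE/= partial_sumE.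
move=> B /nbhs_ballP[e /= e0 eB].
have eE : e = (complex.Re e)%:C by rewrite RRe_real// gtr0_real.
have [|A0 HA] := H (complex.Re e); first by move: e0; rewrite eE ltcR.
exists A0 => //= A /HA; rewrite -eE => AB; apply: eB.
by rewrite -ball_normE/= partial_sumE.
Qed.

Lemma has_sum0 : has_sum (fun i : I => 0 : V) 0.
Proof.
apply/has_sumP => e e0; exists fset0 => A _.
by rewrite big1_eq subr0 normr0 ltcR.
Qed.

Lemma has_sumD x y l m : has_sum x l -> has_sum y m ->
  has_sum (fun i => x i + y i) (l + m).
Proof.
move=> /has_sumP xl /has_sumP ym; apply/has_sumP => e e0.
have [A xA] := xl _ (divr_gt0 e0 (ltr0n _ 2)).
have [B yB] := ym _ (divr_gt0 e0 (ltr0n _ 2)).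
exists (A `|` B)%fset => D; rewrite fsubUset => /andP[/xA xD /yB yD].
rewrite big_split/= opprD addrACA (splitr e) rmorphD/=.
by apply: le_lt_trans (ler_normD _ _) _; exact: ltrD.
Qed.

Lemma has_sumN x l : has_sum x l -> has_sum (fun i => - x i) (- l).
Proof.
move=> /has_sumP xl; apply/has_sumP => e /xl[A xA].
by exists A => D /xA; rewrite sumrN -opprD normrN.
Qed.

Lemma has_sumB x y l m : has_sum x l -> has_sum y m ->
  has_sum (fun i => x i - y i) (l - m).
Proof. by move=> xl /has_sumN; exact: has_sumD. Qed.

End Summation.

Section ScalarSummation.
Context {R : realType} {I : choiceType}.

Lemma has_sum_unique {V : normedModType R[i]} (x : I -> V) l m :
  has_sum x l -> has_sum x m -> l = m.
Proof. by move=> /has_sum_sum <- /has_sum_sum. Qed.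

Lemma has_sumJ (x : I -> R[i]^o) (l : R[i]^o) :
  has_sum x l -> has_sum (fun i => (x i)^* : R[i]^o) (l^* : R[i]^o).
Proof.
move=> /has_sumP xl; apply/has_sumP => e /xl[A xA]; exists A => D /xA.
by rewrite -(raddf_sum (@conjc R)) -(raddfB (@conjc R)) normcJ.
Qed.

Lemma has_sum_real (a : I -> R) : (forall i, 0 <= a i) ->
  (\esum_(i in [set: I]) (a i)%:E < +oo)%E ->
  has_sum (fun i => (a i)%:C : R[i]^o)
    ((fine (\esum_(i in [set: I]) (a i)%:E))%:C : R[i]^o).
Proof.
move=> a0 aoo; set L := fine _.
have LE : (\esum_(i in [set: I]) (a i)%:E = L%:E)%E.
  by rewrite /L fineK// ge0_fin_numE// esum_ge0// => i _; rewrite lee_fin.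
have ub (A : {fset I}) : \sum_(i <- A) a i <= L.
  by move: A; apply/esum_setT_le; rewrite LE.
apply/has_sumP => e e0; have [A0 HA] := esum_setT_adherent e0 aoo a0.
exists A0 => A /(ler_big_fset_subset a0) sA.
rewrite -(raddf_sum (real_complex R)) -(raddfB (real_complex R)) normc_def/=.
rewrite expr0n addr0 sqrtr_sqr ltcR ger0_norm ?subr_ge0//.
by rewrite -/L in HA; rewrite ltrBlDr -ltrBlDl; exact: lt_le_trans HA sA.
Qed.

End ScalarSummation.

(** * The space of families and the synthesis operator *)

Section HilbertExtra.
Context {R : realType} {K : completeNormedModType R[i]}.
Variable ip : K -> K -> R[i].
Hypothesis hip : hilbert_product ip.

Lemma ip_self x : ip x x = (ipnorm ip x ^+ 2)%:C.
Proof.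
rewrite (ipnorm_sqr hip); case: hip => _ ipC _ _.
by have := ipC x x; case: (ip x x) => a b [] /eqP;
rewrite -addr_eq0 -mulr2n mulrn_eq0/= => /eqP ->.
Qed.

(** Real and imaginary parts are bounded separately, whence the crude factor 2, which is harmless
    because the bound only serves to prove convergence. *)
Lemma norm_ip_le x y : `|ip x y| <= (2 * (ipnorm ip x * ipnorm ip y))%:C.
Proof.
have := r_le_ipnorm hip x y; have := r_le_ipnorm hip x ('i *: y).
rewrite -(ip_Im hip) (ipnormZC hip) /= expr0n/= add0r expr1n sqrtr1 mul1r.
case: (ip x y) => a b /= Hb Ha; rewrite normc_def/= lecR.
have m0 : 0 <= ipnorm ip x * ipnorm ip y := le_trans (normr_ge0 a) Ha.
rewrite -(@ler_pXn2r _ 2)// ?nnegrE ?mulr_ge0 ?sqrtr_ge0//.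
rewrite sqr_sqrtr ?addr_ge0 ?sqr_ge0//.
move: Ha Hb; rewrite !ler_norml => /andP[? ?] /andP[? ?]; nra.
Qed.

Lemma ipBl x y z : ip (x - y) z = ip x z - ip y z.
Proof.
case: hip => ipl _ _ _.
by rewrite addrC -scaleN1r ipl mulN1r addrC.
Qed.

Lemma ip0l z : ip 0 z = 0. Proof. by rewrite -(subrr 0) ipBl subrr. Qed.

Lemma ip_suml (I : Type) (s : seq I) (F : I -> K) z :
  ip (\sum_(i <- s) F i) z = \sum_(i <- s) ip (F i) z.
Proof.
elim: s => [|i s IH]; first by rewrite !big_nil ip0l.
case: hip => ipl _ _ _.
by rewrite !big_cons -IH -[in LHS](scale1r (F i)) ipl mul1r.
Qed.

Lemma ipZr (t : R) x y : ip x (t%:C *: y) = ip (t%:C *: x) y.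
Proof.
case: hip => ipl ipC _ _.
rewrite ipC -[_ *: y]addr0 -[_ *: x]addr0 !ipl !ip0l !addr0 (ipC x y).
by case: (ip y x) => a b /=; apply/eqP; rewrite eq_complex/=; apply/andP; split; apply/eqP; ring.
Qed.

Lemma ip0r z : ip z 0 = 0.
Proof. by case: hip => _ ipC _ _; rewrite ipC ip0l; exact: conjc0. Qed.

End HilbertExtra.

Section Synthesis.
Context {R : realType} {K : completeNormedModType R[i]}.
Variables (form : {hermitian_sym K for @conjc R}) (J : {linear K -> K}).
Hypothesis hip : hilbert_product (J_ip form J).
Context {I : choiceType}.
Variables (W : I -> set K) (v : I -> R) (P : set I) (B : R).
Hypotheses (Wsub : forall i, submod_closed [in W i]).
Hypotheses (Wclosed : forall i, closed (W i)) (v_gt0 : forall i, 0 < v i).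
Hypothesis B_gt0 : 0 < B.
Hypothesis besselB : forall f (A : {fset I}),
  \sum_(i <- A) v i ^+ 2 * J_norm form J (J_proj form J (W i) f) ^+ 2
    <= B * J_norm form J f ^+ 2.

Local Notation ip := (J_ip form J).
Local Notation N := (J_norm form J).
Local Notation pi i := (J_proj form J (W i)).
Local Notation E2 := (ell2 form J W).
Let r x y := complex.Re (ip x y).
Let sr : sym_form r := hilbert_sym_form hip.
Let N0 x : 0 <= N x := ipnorm_ge0 ip x.
Let NZ (t : R) x : N (t%:C *: x) = `|t| * N x := ipnormZ hip t x.
Let NE x : ipnorm ip x = N x := erefl.
Let Nz : N 0 = 0 := ipnorm0 hip.
Let NN x : N (- x) = N x := ipnormN hip x.
Let Nsqr x : N x ^+ 2 = r x x := ipnorm_sqr hip x.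

Definition restr (x : I -> K) i : K := if `[< P i >] then x i else 0.

(** The adjoint [T^*] of [synthesis_on P]; the projection onto the indices in [P] shows up as
    [restr]. *)
Definition analysis (y : K) : I -> K :=
  restr (fun i => (v i)%:C *: pi i y).

(** The squared l2 norm as a real number; [fine] loses nothing on members of [ell2]. *)
Definition sqnorm (x : I -> K) : R :=
  fine (\esum_(i in [set: I]) (N (x i) ^+ 2)%:E).

Lemma ell2P Q x : E2 Q x <-> [/\ forall i, W i (x i), forall i, ~ Q i -> x i = 0
  & exists C, forall A : {fset I}, \sum_(i <- A) N (x i) ^+ 2 <= C].
Proof.
split=> [[Wx Qx xoo]|[Wx Qx [C xC]]]; split=> //.
  exists (sqnorm x); apply/esum_setT_le.
  by rewrite fineK// ge0_fin_numE// esum_ge0// => i _; rewrite lee_fin sqr_ge0.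
by apply: le_lt_trans (ltry C); apply/esum_setT_le.
Qed.

Lemma ell2_sqnorm Q x : E2 Q x ->
  has_sum (fun i => ip (x i) (x i) : R[i]^o) ((sqnorm x)%:C : R[i]^o).
Proof.
case=> _ _ xoo; rewrite (_ : (fun i => _) = fun i => (N (x i) ^+ 2)%:C).
  by apply: has_sum_real => // i; exact: sqr_ge0.
by apply/funext => i; rewrite (ip_self hip).
Qed.

Lemma ell2_ip_self Q x : E2 Q x -> ell2_ip form J x x = (sqnorm x)%:C.
Proof. by move=> /ell2_sqnorm /has_sum_sum. Qed.

Lemma sum_le_sqnorm Q x (A : {fset I}) : E2 Q x ->
  \sum_(i <- A) N (x i) ^+ 2 <= sqnorm x.
Proof.
case=> _ _ xoo; move: A; apply/esum_setT_le.
by rewrite fineK// ge0_fin_numE// esum_ge0// => i _; rewrite lee_fin sqr_ge0.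
Qed.

Lemma sqnorm_ge0 x : 0 <= sqnorm x.
Proof. by apply/fine_ge0/esum_ge0 => i _; rewrite lee_fin sqr_ge0. Qed.

Lemma ell2_norm Q x : E2 Q x -> ipnorm (ell2_ip form J) x = Num.sqrt (sqnorm x).
Proof. by move=> xQ; rewrite /ipnorm (ell2_ip_self xQ). Qed.

Lemma sqnorm_eq0 Q x : E2 Q x -> sqnorm x = 0 -> x = 0.
Proof.
move=> xQ x0; apply/funext => i; apply: (ipnorm_eq0 hip); apply/eqP.
rewrite -sqrf_eq0 eq_le sqr_ge0 andbT.
by have := sum_le_sqnorm [fset i]%fset xQ; rewrite big_seq_fset1 x0.
Qed.

Lemma ell2B Q x y : E2 Q x -> E2 Q y -> E2 Q (x - y).
Proof.
move=> /ell2P[Wx Qx [C xC]] /ell2P[Wy Qy [D yD]]; apply/ell2P; split.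
- by move=> i; rewrite fctE; exact: submodB.
- by move=> i nQi; rewrite -[LHS]/(x i - y i) Qx// Qy// subrr.
- exists (2 * C + 2 * D) => A.
  apply: (@le_trans _ _ (\sum_(i <- A) (2 * N (x i) ^+ 2 + 2 * N (y i) ^+ 2))).
    apply: ler_sum => i _; rewrite -[(x - y) i]/(x i - y i) !Nsqr !(sfE sr) (sfC sr (y i)).
    have := Nsqr (x i + y i); rewrite !(sfE sr) (sfC sr (y i)).
    have := sqr_ge0 (N (x i + y i)); lra.
  rewrite big_split/= -!mulr_sumr; apply: lerD; rewrite ler_wpM2l//.
Qed.

Lemma restr_ell2 Q x : E2 Q x -> E2 P (restr x).
Proof.
move=> /ell2P[Wx _ [C xC]]; apply/ell2P; split.
- by move=> i; rewrite /restr; case: asboolP => _ //; exact: submod0.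
- by move=> i nPi; rewrite /restr; case: asboolP.
- exists C => A; apply: le_trans (xC A); apply: ler_sum => i _.
  by rewrite /restr; case: ifP => // _; rewrite Nz expr0n sqr_ge0.
Qed.

Lemma ell2_setT Q x : E2 Q x -> E2 [set: I] x.
Proof. by case=> Wx _ xoo; split=> // i; case. Qed.

(** [x - restr x] lives off [P] and members of [E2 P] live on [P], so the product vanishes term by
    term. *)
Lemma orth_proj_ell2 x : E2 [set: I] x -> orth_proj (ell2_ip form J) (E2 P) x = restr x.
Proof.
move=> xT; have rP := restr_ell2 xT.
apply: xget_unique.
  split=> // z [_ Pz _]; rewrite /ell2_ip.
  rewrite (_ : (fun i => _) = fun i => 0).
    exact: has_sum_sum (@has_sum0 R I R[i]^o).
  apply/funext => i; rewrite -[(x - _) i]/(x i - restr x i) /restr; case: (asboolP (P i)) => Pi.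
    by rewrite subrr (ip0l hip).
  by rewrite (Pz _ Pi) (ip0r hip).
(* For a second candidate [y], the test family is [restr x - y]. It vanishes off [P], and on [P] the
   families [x] and [restr x] agree, so its product with [x - y] is its own squared norm. *)
move=> y [yP] /(_ _ (ell2B rP yP)).
rewrite /ell2_ip (_ : (fun i => _) = fun i => ip ((restr x - y) i) ((restr x - y) i)).
  rewrite -/(ell2_ip form J _ _) (ell2_ip_self (ell2B rP yP)) => -[].
  by move/(sqnorm_eq0 (ell2B rP yP))/eqP; rewrite subr_eq0 => /eqP.
apply/funext => i; rewrite -[(x - _) i]/(x i - y i) -[(restr x - _) i]/(restr x i - y i).
rewrite /restr; case: (asboolP (P i)) => // Pi.
by case: yP => _ /(_ _ Pi) -> _; rewrite subrr !(ip0r hip).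
Qed.

(* The synthesis bound is the Bessel bound by duality: test [u] against
   itself and apply AM-GM termwise. *)
Lemma bessel_synthesis_fin x (A : {fset I}) : (forall i, W i (x i)) ->
  N (\sum_(i <- A) (v i)%:C *: x i) ^+ 2 <= B * \sum_(i <- A) N (x i) ^+ 2.
Proof.
move=> Wx; set u := \sum_(i <- A) _.
(* The weights are chosen so that the Bessel inequality turns the second sum into at most half of
   [N u ^+ 2], which the left side absorbs. *)
have : N u ^+ 2 <= \sum_(i <- A)
    (B / 2 * N (x i) ^+ 2 + (2 * B)^-1 * (v i ^+ 2 * N (pi i u) ^+ 2)).
  rewrite Nsqr {1}/u (sf_suml sr); apply: ler_sum => i _.
  have Ei : r u (x i) = r (pi i u) (x i).
    exact: esym (orth_proj_Re hip (Wsub i) (@Wclosed i) u (Wx i)).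
  have : `|r (pi i u) (x i)| <= N (pi i u) * N (x i) by exact: r_le_ipnorm.
  rewrite (sfZl sr) (sfC sr (x i)) Ei ler_norml => /andP[_].
  move: (r _ _) (N (pi i u)) (N (x i)) => s a b sab.
  apply: (@le_trans _ _ (v i * (a * b))); first by rewrite ler_pM2l.
  rewrite -subr_ge0 (_ : _ - _ = (2 * B)^-1 * (B * b - v i * a) ^+ 2).
    by rewrite mulr_ge0 ?sqr_ge0 ?invr_ge0 ?mulr_ge0 ?ltW.
  by field; rewrite gt_eqF.
rewrite big_split/= -!mulr_sumr => /le_trans H.
have H2 := H _ (lerD (lexx _) (ler_wpM2l _ (besselB u A))).
have : N u ^+ 2 <= B / 2 * \sum_(i <- A) N (x i) ^+ 2 + (2 * B)^-1 * (B * N u ^+ 2).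
  by apply: H2; rewrite invr_ge0 mulr_ge0 ?ltW.
rewrite (_ : (2 * B)^-1 * (B * N u ^+ 2) = N u ^+ 2 / 2); first by lra.
by field; rewrite gt_eqF.
Qed.

(** The net is Cauchy: beyond a finite set that captures the squared norm up to [e ^+ 2 / B], the
    finite synthesis bound makes every further contribution shorter than [e]. *)
Lemma synthesis_cvg Q x : E2 Q x ->
  has_sum (fun i => (v i)%:C *: x i) (synthesis v x).
Proof.
move=> xQ; have FF := @summability.totally_filter I.
suff : cvg (summability.partial_sum (fun i => (v i)%:C *: x i) @ summability.totally) by [].
apply: (complete_ipnorm hip) => e e0.
have d0 : 0 < e ^+ 2 / B by rewrite divr_gt0 ?exprn_gt0.
have [Wx _ xoo] := xQ.
have [A0 HA] := esum_setT_adherent d0 xoo (fun i => sqr_ge0 (N (x i))).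
exists (\sum_(i <- A0) (v i)%:C *: x i), A0 => //= A sA; rewrite partial_sumE NE.
rewrite (big_fset_subset _ sA) opprD addrA subrr add0r NN.
rewrite -(@ltr_pXn2r _ 2)// ?nnegrE ?N0 ?(ltW e0)//.
apply: le_lt_trans (bessel_synthesis_fin _ Wx) _.
rewrite mulrC -ltr_pdivlMr//.
have := sum_le_sqnorm A xQ; rewrite (big_fset_subset _ sA).
by move: HA; rewrite -/(sqnorm x) => HA H; rewrite -(ltrD2l (\sum_(i <- A0) N (x i) ^+ 2)); lra.
Qed.

Local Notation T := (synthesis_on form J W v P).

Lemma synthesis_on_cvg x : E2 [set: I] x ->
  has_sum (fun i => (v i)%:C *: restr x i) (T x).
Proof.
move=> xT; rewrite /synthesis_on orth_proj_ell2//.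
exact: synthesis_cvg (restr_ell2 xT).
Qed.

Lemma synthesis_onB x y : E2 [set: I] x -> E2 [set: I] y -> T (x - y) = T x - T y.
Proof.
move=> xT yT; apply: has_sum_unique (synthesis_on_cvg (ell2B xT yT)) _.
rewrite (_ : (fun i => _) = fun i => (v i)%:C *: restr x i - (v i)%:C *: restr y i).
  by apply: has_sumB; exact: synthesis_on_cvg.
apply/funext => i; rewrite -scalerBr /restr -[(x - y) i]/(x i - y i).
by case: asboolP; rewrite ?subr0.
Qed.

Lemma synthesis_on_bound x : E2 [set: I] x -> N (T x) <= Num.sqrt (B * sqnorm x).
Proof.
move=> xT; apply/ler_addgt0Pr => e e0.
have /has_sumP/(_ _ e0)[A /(_ A (fsubset_refl A))] := synthesis_on_cvg xT.
case: hip => _ _ _ nE; rewrite nE ltcR NE => /ltW xA.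
set u := \sum_(i <- A) _ in xA.
have -> : T x = u + (T x - u) by rewrite addrC subrK.
apply: le_trans (ler_ipnormD hip _ _) _; apply: lerD => //.
rewrite NE -(ger0_norm (N0 u)) -sqrtr_sqr ler_sqrt; last by rewrite mulr_ge0 ?sqnorm_ge0// ltW.
  apply: le_trans (bessel_synthesis_fin _ _) _.
    by case: (restr_ell2 xT).
  rewrite ler_pM2l//; apply: le_trans (sum_le_sqnorm A xT).
  apply: ler_sum => i _; rewrite /restr; case: ifP => // _.
  by rewrite Nz expr0n sqr_ge0.
Qed.

Lemma analysis_ell2 y : E2 P (analysis y).
Proof.
apply: (@restr_ell2 [set: I]); apply/ell2P; split.
- by move=> i; apply: submodZ => //; exact: orth_proj_mem.
- by move=> i; case.
- exists (B * N y ^+ 2) => A; apply: le_trans (besselB y A).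
  by apply: ler_sum => i _; rewrite NZ exprMn real_normK ?num_real.
Qed.

(** The identity [<T x, y> = <x, T^* y>], in a form that also contains the convergence of the right
    side. *)
Lemma analysis_adjoint x y : E2 [set: I] x ->
  has_sum (fun i => ip (x i) (analysis y i) : R[i]^o) (ip (T x) y : R[i]^o).
Proof.
move=> xT; apply/has_sumP => e e0.
(* The 2 is the factor of [norm_ip_le]; the 1 covers [y = 0]. *)
have k0 : 0 < 2 * N y + 1 by have := N0 y; lra.
have /has_sumP/(_ _ (divr_gt0 e0 k0))[A xA] := synthesis_on_cvg xT.
exists A => D /xA; case: (hip) => _ _ _ nE; rewrite nE ltcR NE.
rewrite (_ : \sum_(i <- D) ip (x i) (analysis y i) =
    ip (\sum_(i <- D) (v i)%:C *: restr x i) y).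
  rewrite -(ipBl hip); set u := T x - _ => uA.
  apply: le_lt_trans (norm_ip_le hip _ _) _; rewrite ltcR !NE.
  by move: uA; rewrite ltr_pdivlMr// => uA; have := N0 u; nra.
rewrite (ip_suml hip); apply: eq_bigr => i _; rewrite /analysis /restr.
case: asboolP => Pi; last by rewrite scaler0 (ip0r hip) (ip0l hip).
rewrite (ipZr hip).
have [_ o] := orth_projP hip (Wsub i) (@Wclosed i) y.
have Wx : W i ((v i)%:C *: x i) by apply: submodZ => //; case: xT.
have := o _ Wx; rewrite (ipBl hip) => /eqP; rewrite subr_eq0 => /eqP.
by case: (hip) => _ ipC _ _ E; rewrite ipC -[J_proj _ _ _ _]/(orth_proj _ _ _) -E -ipC.
Qed.

End Synthesis.

(** * The operator T T^* *)

Section FrameOperator.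
Context {R : realType} {K : completeNormedModType R[i]}.
Variables (form : {hermitian_sym K for @conjc R}) (J : {linear K -> K}).
Hypothesis krein : krein_space form J.
Context {I : choiceType}.
Variables (W : I -> set K) (v : I -> R) (P : set I) (B : R).
Hypotheses (Wsub : forall i, submod_closed [in W i]).
Hypotheses (Wclosed : forall i, closed (W i)) (v_gt0 : forall i, 0 < v i).
Hypothesis B_gt0 : 0 < B.
Hypothesis besselB : forall f (A : {fset I}),
  \sum_(i <- A) v i ^+ 2 * J_norm form J (J_proj form J (W i) f) ^+ 2
    <= B * J_norm form J f ^+ 2.

Let hip := hilbert_J_ip krein.
Local Notation ip := (J_ip form J).
Local Notation N := (J_norm form J).
Local Notation pi i := (J_proj form J (W i)).
Local Notation E2T := (ell2 form J W [set: I]).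
Local Notation ana := (analysis form J W v P).
Local Notation T := (synthesis_on form J W v P).
Local Notation S y := (T (ana y)).
Let r x y := complex.Re (ip x y).
Let sr : sym_form r := hilbert_sym_form hip.
Let N0 x : 0 <= N x := ipnorm_ge0 ip x.

Let NZ (t : R) x : N (t%:C *: x) = `|t| * N x := ipnormZ hip t x.
Let Nz : N 0 = 0 := ipnorm0 hip.
Let rN x y : `|r x y| <= N x * N y := r_le_ipnorm hip x y.

Let ana_ell2 y : E2T (ana y) := ell2_setT (analysis_ell2 hip P Wsub Wclosed besselB y).
Let adj x y : E2T x ->
    has_sum (fun i => ip (x i) (ana y i) : R[i]^o) (ip (T x) y : R[i]^o) :=
  analysis_adjoint (P := P) hip Wsub Wclosed v_gt0 B_gt0 besselB (x := x) (y := y).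
Let T_cvg x : E2T x -> has_sum (fun i => (v i)%:C *: restr P x i) (T x) :=
  synthesis_on_cvg (P := P) hip Wsub Wclosed v_gt0 B_gt0 besselB (x := x).
Let TB x y : E2T x -> E2T y -> T (x - y) = T x - T y :=
  synthesis_onB hip P Wsub Wclosed v_gt0 B_gt0 besselB (x := x) (y := y).
Let T_bound x : E2T x -> N (T x) <= Num.sqrt (B * sqnorm form J x) :=
  synthesis_on_bound hip P Wsub Wclosed v_gt0 B_gt0 besselB (x := x).

Lemma adjointC x y : E2T x ->
  has_sum (fun i => ip (ana y i) (x i) : R[i]^o) (ip y (T x) : R[i]^o).
Proof.
move=> xT; have ipC : forall x y, ip x y = (ip y x)^* by case: hip.
rewrite ipC (_ : (fun i => _) = fun i => (ip (x i) (ana y i))^*).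
  by apply: has_sumJ; exact: adj.
by apply/funext => i; rewrite ipC.
Qed.

(** Both sides are the real part of [<T^* y, T^* z>]. *)
Lemma frame_opC y z : r (S y) z = r (S z) y.
Proof.
have H1 := @adj (ana y) z (ana_ell2 y); have H2 := @adjointC (ana z) y (ana_ell2 z).
by rewrite [RHS](sfC sr) /r (has_sum_unique H1 H2).
Qed.

Lemma sqnorm_analysis y : sqnorm form J (ana y) = r (S y) y.
Proof.
have H1 := ell2_sqnorm hip (ana_ell2 y); have H2 := @adj (ana y) y (ana_ell2 y).
by have := has_sum_unique H1 H2; rewrite /r => <-.
Qed.

Lemma sqnorm_analysis_le y : sqnorm form J (ana y) <= B * N y ^+ 2.
Proof.
rewrite -lee_fin /sqnorm fineK.
  apply/esum_setT_le => A; apply: le_trans (besselB y A); apply: ler_sum => i _.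
  rewrite /analysis /restr; case: ifP => _.
    by rewrite NZ exprMn real_normK ?num_real.
  by rewrite Nz expr0n mulr_ge0 ?sqr_ge0.
case: (ana_ell2 y) => _ _ xoo.
by rewrite ge0_fin_numE// esum_ge0// => i _; rewrite lee_fin sqr_ge0.
Qed.

Lemma frame_op_bounded y z : `|r (S y) z| <= B * (N y * N z).
Proof.
apply: le_trans (rN (S y) z) _; rewrite mulrA ler_wpM2r//.
apply: le_trans (T_bound (ana_ell2 y)) _.
have BN : 0 <= B * N y by rewrite mulr_ge0// ltW.
rewrite -(ger0_norm BN) -sqrtr_sqr ler_wsqrtr// exprMn.
by rewrite expr2 -mulrA ler_pM2l// sqnorm_analysis_le.
Qed.

Lemma analysis_orth_null y x : E2T x -> T x = 0 -> ell2_ip form J (ana y) x = 0.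
Proof.
move=> xT Tx; have := @adjointC x y xT; rewrite Tx (ip0r hip).
exact: has_sum_sum.
Qed.

(** [x - T^* y] lies in the null space of [T] and is orthogonal to it, hence is zero. *)
Lemma null_orth_analysis x y : orth_compl (ell2_ip form J) E2T (null_space E2T T) x ->
  T x = S y -> x = ana y.
Proof.
case=> xT xo; have := ana_ell2 y; have := fun z => @adjointC z y.
move: (ana y) => a adja aT Txy; have nT := ell2B hip Wsub xT aT.
have Tn : T (x - a) = 0.
  by apply/eqP; rewrite (TB xT aT) Txy (addrN (T a)).
have E : (fun i => ip (x i) ((x - a) i) : R[i]^o) =
    fun i => ip ((x - a) i) ((x - a) i) + ip (a i) ((x - a) i).
  by apply/funext => i; rewrite (ipBl hip) subrK.
have xn : ell2_ip form J x (x - a) = (sqnorm form J (x - a))%:C.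
  rewrite /ell2_ip E; apply: (has_sum_sum (V := R[i]^o)).
  have := has_sumD (ell2_sqnorm hip nT) (adja _ nT).
  by rewrite Tn (ip0r hip) addr0.
have : (sqnorm form J (x - a))%:C = 0 :> R[i] by rewrite -xn; exact: (xo _ (conj nT Tn)).
by case=> /(sqnorm_eq0 hip nT)/eqP; rewrite subr_eq0 => /eqP.
Qed.

(** [J] is symmetric with square 1, so [[pi (J f), f] = <pi (J f), J f> = |pi (J f)|^2], which is
    already nonnegative. *)
Lemma frame_sumE f : frame_sum form J W v P f = (sqnorm form J (ana (J f)))%:E.
Proof.
rewrite /sqnorm fineK; last first.
  case: (ana_ell2 (J f)) => _ _ xoo.
  by rewrite ge0_fin_numE// esum_ge0// => i _; rewrite lee_fin sqr_ge0.
rewrite /frame_sum esum_mkcond; apply: eq_esum => i _.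
rewrite /analysis /restr; have -> : (i \in P) = `[< P i >] by [].
case: ifP => _; last by rewrite Nz expr0n.
rewrite NZ exprMn real_normK ?num_real//; congr (_ * _)%:E.
have [JJ Jsym _] := J_involution krein; have ipC : forall x y, ip x y = (ip y x)^* by case: hip.
have -> : form (pi i (J f)) f = ip (pi i (J f)) (J f) by rewrite /J_ip Jsym JJ.
have [Wp /(_ _ Wp)] := orth_projP hip (Wsub i) (@Wclosed i) (J f).
rewrite (ipBl hip) => /eqP; rewrite subr_eq0 => /eqP E.
by rewrite ipC E -ipC (ip_self hip) normc_real ger0_norm// sqr_ge0.
Qed.

Local Notation M := (closed_sum W P).
Let X := [set x | exists (A : {fset I}) (g : I -> K),
    (forall i, i \in A -> P i /\ W i (g i)) /\ x = \sum_(i <- A) g i].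

Lemma range_sub_closed_sum : range_synthesis_on form J W v P `<=` M.
Proof.
move=> _ [x xT <-]; apply/(closure_ipnorm hip) => e e0.
have /has_sumP/(_ _ e0)[A /(_ A (fsubset_refl A))] := T_cvg xT.
case: (hip) => _ _ _ nE; rewrite nE ltcR => xA.
exists (\sum_(i <- A) (v i)%:C *: restr P x i) => //.
exists [fset i in A | `[< P i >]]%fset, (fun i => (v i)%:C *: x i); split.
  move=> i; rewrite !inE/= => /andP[_ /asboolP Pi]; split=> //.
  by apply: submodZ => //; case: xT.
rewrite -big_fset_condE [RHS]big_mkcond/=; apply: eq_bigr => i _.
by rewrite /restr; case: ifP => // _; rewrite scaler0.
Qed.

Lemma fin_sums_sub_range : X `<=` range_synthesis_on form J W v P.
Proof.
move=> _ [A [g [Pg ->]]].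
pose y i := if i \in A then (v i)^-1%:C *: g i else 0.
have yT : E2T y.
  apply/ell2P; split=> [i|i []//|].
    rewrite /y; case: ifP => iA; last exact: submod0.
    by apply: submodZ => //; case: (Pg _ iA).
  exists (\sum_(i <- A) N (y i) ^+ 2) => D.
  apply: le_trans (@ler_big_fset_subset _ _ _ (A `|` D)%fset _ _ _) _ => //.
  - by move=> i; exact: sqr_ge0.
  - exact: fsubsetUr.
  rewrite le_eqVlt; apply/orP; left; apply/eqP/esym/big_fset_incl; first exact: fsubsetUl.
  move=> i _ iA; rewrite /y (negbTE iA); apply/eqP.
  by rewrite sqrf_eq0; apply/eqP/Nz.
exists y => //; apply: has_sum_unique (T_cvg yT) _; apply/has_sumP => e e0.
exists A => D AD; rewrite (_ : _ - _ = 0) ?normr0 ?ltcR//; apply/eqP; rewrite subr_eq0; apply/eqP.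
rewrite -(big_fset_incl _ AD) => [|i _ iA].
  rewrite big_seq [RHS]big_seq; apply: eq_bigr => i iA; have [Pi _] := Pg _ iA.
  rewrite /restr /y iA; case: asboolP => // _.
  by rewrite scalerA -rmorphM/= divff ?scale1r// gt_eqF.
by rewrite /restr /y (negbTE iA) if_same scaler0.
Qed.

Lemma closed_sum_sub i : P i -> W i `<=` M.
Proof.
move=> Pi x Wx; apply: subset_closure; exists [fset i]%fset, (fun=> x); split.
  by move=> j /[!inE] /eqP ->.
by rewrite big_seq_fset1.
Qed.

(** The range lies between the algebraic sum of the [W i] and its closure. *)
Lemma closure_range : closure (range_synthesis_on form J W v P) = M.
Proof.
apply/seteqP; split; last exact: closureS fin_sums_sub_range.
apply: subset_trans (closureS range_sub_closed_sum) _.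
exact: closed_closure.
Qed.

End FrameOperator.

(** * The Gramian *)

Section Gramian.
Context {R : realType} {K : completeNormedModType R[i]}.
Variables (form : {hermitian_sym K for @conjc R}) (J : {linear K -> K}).
Hypothesis krein : krein_space form J.
Variables (M : set K) (e al : R).
Hypotheses (Msub : submod_closed [in M]) (Mclosed : closed M).
Hypotheses (e2 : e * e = 1) (al_gt0 : 0 < al).
Hypothesis Mpos : forall f, M f -> al * J_norm form J f ^+ 2 <= e * qform form f.

Let hip := hilbert_J_ip krein.
Local Notation ip := (J_ip form J).
Local Notation N := (J_norm form J).
Local Notation G := (gramian form J M).
Local Notation gG := (gamma_gramian form J M).
Let r x y := complex.Re (ip x y).
Let sr : sym_form r := hilbert_sym_form hip.
Let q x y := e * complex.Re (form x y).
Let sq : sym_form q := sym_form_form form e.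
Let N0 x : 0 <= N x := ipnorm_ge0 ip x.
Let Nsqr x : N x ^+ 2 = r x x := ipnorm_sqr hip x.
Let rN x y : `|r x y| <= N x * N y := r_le_ipnorm hip x y.
Let NZ (t : R) x : N (t%:C *: x) = `|t| * N x := ipnormZ hip t x.

Let abs_e : `|e| = 1.
Proof.
apply/eqP; rewrite -(@eqrXn2 _ 2)// expr1n -normrX expr2 e2 normr1//.
Qed.

Lemma gramian_mem f : M (G f). Proof. exact: orth_proj_mem. Qed.

Lemma gramian_Re f g : M g -> r (G f) g = complex.Re (form f g).
Proof.
by move=> Mg; rewrite (form_J_ip krein); exact: (orth_proj_Re hip Msub Mclosed).
Qed.

Lemma qform_le f : e * qform form f <= N f ^+ 2.
Proof.
apply: le_trans (ler_norm _) _; rewrite normrM abs_e mul1r expr2.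
exact: form_bound.
Qed.

(** [al |f|^2 <= e <G f, f> <= |G f| |f|]. *)
Lemma gramian_lower f : M f -> al * N f <= N (G f).
Proof.
move=> Mf; have := Mpos Mf; rewrite /qform -gramian_Re//.
have := rN (G f) f; have := N0 f; rewrite le_eqVlt => /predU1P[<-|f0] H1 H2.
  by rewrite mulr0.
have : e * r (G f) f <= N (G f) * N f.
  by apply: le_trans H1; apply: le_trans (ler_norm _) _; rewrite normrM abs_e mul1r.
by move=> /(le_trans H2); rewrite expr2 mulrA ler_pM2r.
Qed.

Lemma gramian_norm f : N (G f) <= N f.
Proof. by rewrite -(J_norm_J krein f); exact: (orth_proj_norm hip Msub Mclosed). Qed.

(* Cauchy-Schwarz for [e *: [., .]], positive on [M], at [f] and [G f]. *)
Lemma gramian_sqr f : M f -> N (G f) ^+ 2 <= e * qform form f.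
Proof.
move=> Mf; have MG := gramian_mem f.
have q0 z : M z -> 0 <= q z z.
  by move=> /Mpos; apply: le_trans; rewrite mulr_ge0 ?sqr_ge0 ?ltW.
have := cauchy_schwarz sq Msub q0 Mf MG.
(* [q f (G f) = e |G f|^2], so Cauchy-Schwarz reads [|G f|^4 <= q f f * q (G f) (G f)], and the last
   factor is at most [|G f|^2]. *)
have -> : q f (G f) ^+ 2 = (N (G f) ^+ 2) ^+ 2.
  by rewrite /q -gramian_Re// -Nsqr exprMn [e ^+ 2]e2 mul1r.
have := qform_le (G f); rewrite -/(q _ _) => qG H.
have := q0 _ Mf; rewrite -/(q f f) => qf0.
have [->|G0] := eqVneq (N (G f)) 0; first by rewrite expr0n.
have GG : 0 < N (G f) ^+ 2 by rewrite exprn_gt0// lt_neqAle eq_sym G0 N0.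
rewrite -(ler_pM2r GG) -expr2; apply: le_trans H _.
by rewrite ler_wpM2l.
Qed.

Lemma gramian_onto y : M y -> exists2 f, M f & G f = y.
Proof.
move=> My.
have qb f g : `|q f g| <= 1 * (N f * N g).
  by rewrite mul1r normrM abs_e mul1r; exact: form_bound.
(* The factor [e] on the right side cancels the one inside [q]. *)
have [f Mf fy] := sym_lax_milgram hip Msub Mclosed sq al_gt0 ler01 Mpos qb (e%:C *: y).
exists f => //; apply: (orth_proj_unique hip Msub Mclosed) => // z Mz.
have := fy z Mz; rewrite -[RHS]/(r _ _) (sfZl sr) /q => /(congr1 ( *%R e)).
by rewrite !mulrA e2 !mul1r (form_J_ip krein) => ->.
Qed.

Hypothesis Mnz : exists2 f, M f & f != 0.

(** Keeps the set under the infimum in [gG] nonempty. *)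
Lemma exists_unit : exists2 f, M f & N f = 1.
Proof.
have [f Mf f0] := Mnz; have Nf : N f != 0.
  by apply: contra f0 => /eqP /(ipnorm_eq0 hip) ->.
exists ((N f)^-1%:C *: f); first exact: submodZ.
by rewrite NZ ger0_norm ?invr_ge0// mulVf.
Qed.

(** [gramian_lower] makes [G] injective on [M], so [gG] is an infimum over the whole unit sphere of
    [M]. *)
Lemma orth_compl_gramian x : M x -> orth_compl ip M (null_space M G) x.
Proof.
move=> Mx; split=> // y [My Gy]; have := gramian_lower My.
rewrite Gy (_ : N 0 = 0); last exact: (ipnorm0 hip).
rewrite pmulr_rle0// => yN; suff -> : y = 0 by exact: (ip0r hip).
by apply: (ipnorm_eq0 hip); apply/eqP; rewrite eq_le yN; exact: N0.
Qed.

Lemma gamma_gramian_gt0 : 0 < gG.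
Proof.
apply: lt_le_trans al_gt0 _; apply: lb_le_inf.
  have [f Mf f1] := exists_unit.
  by exists (N (G f)), f => //; split=> //; exact: orth_compl_gramian.
move=> _ [x [[Mx _] x1] <-].
by have := gramian_lower Mx; rewrite (_ : N x = 1)// mulr1.
Qed.

Lemma gamma_gramian_le1 : gG <= 1.
Proof.
have [f Mf f1] := exists_unit.
apply: le_trans (_ : N (G f) <= _); last by rewrite -f1 gramian_norm.
apply: ge_inf; first by exists 0 => _ [x _ <-].
by exists f => //; split=> //; exact: orth_compl_gramian.
Qed.

Lemma gamma_gramianP f : M f -> gG * N f <= N (G f).
Proof.
move=> Mf; have [->|f0] := eqVneq (N f) 0; first by rewrite mulr0.
have f1 : 0 < N f by rewrite lt_neqAle eq_sym f0 N0.
rewrite -ler_pdivlMr// mulrC.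
have -> : (N f)^-1 * N (G f) = N (G ((N f)^-1%:C *: f)).
  have -> : G ((N f)^-1%:C *: f) = (N f)^-1%:C *: G f.
    by rewrite /gramian linearZ; exact: (orth_projZ hip Msub Mclosed).
  by rewrite NZ ger0_norm// invr_ge0.
apply: ge_inf; first by exists 0 => _ [x _ <-].
exists ((N f)^-1%:C *: f) => //; split.
  by apply: orth_compl_gramian; exact: submodZ.
suff : N ((N f)^-1%:C *: f) = 1 by [].
by rewrite NZ ger0_norm ?invr_ge0// mulVf.
Qed.

(** * Estimates for a symmetric operator with values in [M] *)

Section Operator.
Variables (S : K -> K) (B c : R).
Hypotheses (SC : forall y z, r (S y) z = r (S z) y) (SM : forall y, M (S y)).
Hypotheses (B_ge0 : 0 <= B) (Sb : forall y z, `|r (S y) z| <= B * (N y * N z)).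
Hypothesis S_ge0 : forall y, 0 <= r (S y) y.
Hypotheses (c_gt0 : 0 < c).
Hypothesis Sc : forall f, M f -> c * N f ^+ 2 <= r (S (G f)) (G f).

(** The hypothesis only speaks of vectors [G f]; these exhaust [M], and [|G f| <= |f|]. *)
Lemma op_coercive y : M y -> c * N y ^+ 2 <= r (S y) y.
Proof.
move=> My; have [f Mf <-] := gramian_onto My.
apply: le_trans (Sc Mf); rewrite ler_pM2l// ler_pXn2r ?nnegrE//.
exact: gramian_norm.
Qed.

(** Lax-Milgram for [<S ., .>] leaves a residual [S z - y] that is orthogonal to [M] and lies in
    it. *)
Lemma op_onto y : M y -> exists2 z, M z & S z = y.
Proof.
move=> My; have sS := sym_op_form sr SC.
have [z Mz zy] := sym_lax_milgram hip Msub Mclosed sS c_gt0 B_ge0 op_coercive Sb y.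
exists z => //; apply/eqP; rewrite -subr_eq0; apply/eqP/(ip_real_def hip).
have Md : M (S z - y) by exact: submodB.
by rewrite -[LHS]/(r _ _) (sfBl sr) (zy _ Md) subrr.
Qed.

(** Here [sqrt (r (S z) z)] stands for [|T^* z|]. Then [|T^* y|^2 <= |S y| |y| <= nT |T^* y| |y|],
    and one factor cancels. *)
Lemma op_norm_upper (nT : R) y :
  (forall z, N (S z) <= nT * Num.sqrt (r (S z) z)) ->
  r (S y) y <= nT ^+ 2 * N y ^+ 2.
Proof.
move=> nTS; have := nTS y; have := S_ge0 y.
have : r (S y) y <= N (S y) * N y by apply: le_trans (rN _ _); exact: ler_norm.
move=> H1 s0; have sE := sqr_sqrtr s0; move: (sqrtr_ge0 (r (S y) y)) => t0 H2.
rewrite -sE -exprMn.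
have [->|tn] := eqVneq (Num.sqrt (r (S y) y)) 0; first by rewrite expr0n sqr_ge0.
have tp : 0 < Num.sqrt (r (S y) y) by rewrite lt_neqAle eq_sym tn.
suff tl : Num.sqrt (r (S y) y) <= nT * N y.
  by rewrite ler_pXn2r ?nnegrE// (le_trans t0 tl).
rewrite -(ler_pM2r tp) -expr2 sE; apply: le_trans H1 _.
by have := ler_wpM2r (N0 y) H2; rewrite mulrAC.
Qed.

(** Write [y = S z]. The hypothesis gives [gT^2 <y, z> <= |y|^2], and Cauchy-Schwarz for [<S ., .>]
    at [z] and [y] gives [|y|^4 <= <y, z> <S y, y>]; combine and divide by [|y|^2]. *)
Lemma op_norm_lower (gT : R) y : 0 <= gT ->
  (forall z, gT * Num.sqrt (r (S z) z) <= N (S z)) -> M y ->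
  gT ^+ 2 * N y ^+ 2 <= r (S y) y.
Proof.
move=> gT0 gTS My; have [z Mz zy] := op_onto My.
have sS := sym_op_form sr SC.
have S0 u : setT u -> 0 <= r (S u) u by [].
have CS := cauchy_schwarz sS (@submod_closedT _ K) S0 (I : setT z) (I : setT y).
have := gTS z; rewrite zy in CS *.
have -> : N y ^+ 2 = r y y by [].
move: CS; rewrite -Nsqr => CS Hz.
have := exprn_ge0 2 (sqrtr_ge0 (r y z)); rewrite sqr_sqrtr; last by rewrite -zy.
move=> z0.
have H : gT ^+ 2 * r y z <= N y ^+ 2.
  rewrite -[r y z]sqr_sqrtr// -exprMn ler_pXn2r ?nnegrE//.
  by rewrite mulr_ge0// sqrtr_ge0.
have [->|Ny] := eqVneq (N y) 0; first by rewrite expr0n mulr0.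
have Np : 0 < N y ^+ 2 by rewrite exprn_gt0// lt_neqAle eq_sym Ny N0.
rewrite -(ler_pM2r Np).
have Sy := S_ge0 y.
have H2 := ler_wpM2r Sy H; have := ler_wpM2l (sqr_ge0 gT) CS.
by move: (r y z) (r (S y) y) (N y ^+ 2) (gT ^+ 2) H2 => a b n g H2; lra.
Qed.

End Operator.
End Gramian.

(** * Bounds for one sign *)

Section ClosureForm.
Context {R : realType} {K : completeNormedModType R[i]}.
Variable ip : K -> K -> R[i].
Hypothesis hip : hilbert_product ip.
Let N := ipnorm ip.
Let N0 x : 0 <= N x := ipnorm_ge0 ip x.

(** For a point [f - h] of [A], nonnegativity gives [b f f >= 2 b f h - b h h], and boundedness of
    [b] makes the right side small with [h]. *)
Lemma closure_form_ge0 (b : K -> K -> R) (C : R) (A : set K) :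
  sym_form b -> 0 <= C -> (forall x y, `|b x y| <= C * (N x * N y)) ->
  (forall f, A f -> 0 <= b f f) -> forall f, closure A f -> 0 <= b f f.
Proof.
move=> sb C0 bC A0 f /(closure_ipnorm hip) fA; apply/ler_addgt0Pr => e e0.
pose D := C * (2 * N f + 1) + 1.
have D0 : 0 < D by rewrite /D ltr_wpDl// mulr_ge0// addr_ge0// mulr_ge0.
have d0 : 0 < Num.min 1 (e / D) by rewrite lt_min ltr01 divr_gt0.
have [y Ay] := fA _ d0; rewrite lt_min ltr_pdivlMr// => /andP[].
have := A0 _ Ay; rewrite {1 2}(_ : y = f - (f - y)); last by rewrite opprB addrC subrK.
move: (f - y) => h; rewrite !(sfE sb) (sfC sb h f) -/(N h) => b0 h1 hD.
have := bC f h; rewrite ler_norml => /andP[B1 _].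
have := bC h h; rewrite ler_norml => /andP[_ B2].
have B3 : C * (N h * N h) <= C * (1 * N h) by rewrite ler_wpM2l// ler_wpM2r// ltW.
have Nh := N0 h; move: hD; rewrite /D; lra.
Qed.

End ClosureForm.

Section FusionBounds.
Context {R : realType} {K : completeNormedModType R[i]}.
Variables (form : {hermitian_sym K for @conjc R}) (J : {linear K -> K}).
Hypothesis krein : krein_space form J.
Context {I : choiceType}.
Variables (W : I -> set K) (v : I -> R) (P : set I) (B : R).
Hypotheses (Wsub : forall i, submod_closed [in W i]).
Hypotheses (Wclosed : forall i, closed (W i)) (v_gt0 : forall i, 0 < v i).
Hypothesis B_gt0 : 0 < B.
Hypothesis besselB : forall f (A : {fset I}),
  \sum_(i <- A) v i ^+ 2 * J_norm form J (J_proj form J (W i) f) ^+ 2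
    <= B * J_norm form J f ^+ 2.

Let hip := hilbert_J_ip krein.
Local Notation ip := (J_ip form J).
Local Notation N := (J_norm form J).
Local Notation E2T := (ell2 form J W [set: I]).
Local Notation ana := (analysis form J W v P).
Local Notation T := (synthesis_on form J W v P).
Local Notation M := (closed_sum W P).
Local Notation Rg := (range_synthesis_on form J W v P).
Local Notation gT := (gamma_synthesis_on form J W v P).
Local Notation nT := (norm_synthesis_on form J W v P).
Local Notation gG := (gamma_gramian form J M).
Local Notation G := (gramian form J M).
Let r x y := complex.Re (ip x y).
Let sr : sym_form r := hilbert_sym_form hip.
Let N0 x : 0 <= N x := ipnorm_ge0 ip x.
Let NZ (t : R) x : N (t%:C *: x) = `|t| * N x := ipnormZ hip t x.
Let rN x y : `|r x y| <= N x * N y := r_le_ipnorm hip x y.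

Let S y := T (ana y).
Let SC y z : r (S y) z = r (S z) y :=
  frame_opC krein P Wsub Wclosed v_gt0 B_gt0 besselB y z.
Let SE y : sqnorm form J (ana y) = r (S y) y :=
  sqnorm_analysis krein P Wsub Wclosed v_gt0 B_gt0 besselB y.
Let SZ (t : R) y : S (t%:C *: y) = t%:C *: S y := sym_opZ hip t y SC.
Let ana_ell2 y : E2T (ana y) := ell2_setT (analysis_ell2 hip P Wsub Wclosed besselB y).
Let T_bound x : E2T x -> N (T x) <= Num.sqrt (B * sqnorm form J x) :=
  synthesis_on_bound hip P Wsub Wclosed v_gt0 B_gt0 besselB (x := x).
Let ana_norm y : ipnorm (ell2_ip form J) (ana y) = Num.sqrt (r (S y) y).
Proof. by rewrite (ell2_norm hip (ana_ell2 y)) SE. Qed.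
Let S_ge0 y : 0 <= r (S y) y.
Proof. by rewrite -SE; exact: sqnorm_ge0. Qed.

Lemma analysis_normalized z : Num.sqrt (r (S z) z) != 0 ->
  exists2 w, N (T (ana w)) = (Num.sqrt (r (S z) z))^-1 * N (S z)
  & ipnorm (ell2_ip form J) (ana w) = 1.
Proof.
set n := Num.sqrt _ => n0; have np : 0 <= n by exact: sqrtr_ge0.
have nn : n ^+ 2 = r (S z) z by rewrite sqr_sqrtr.
have E : r (S (n^-1%:C *: z)) (n^-1%:C *: z) = 1.
  by rewrite SZ (sfZl sr) (sfZr sr) -nn expr2 mulrA -mulrA mulKf// mulVf.
exists (n^-1%:C *: z); last by rewrite ana_norm E sqrtr1.
by rewrite -[T _]/(S _) SZ NZ ger0_norm// invr_ge0.
Qed.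

(** [T^* z] is orthogonal to the null space of [T], so once normalized it competes in the
    infimum. *)
Lemma gamma_synthesisP z : gT * Num.sqrt (r (S z) z) <= N (S z).
Proof.
have [->|n0] := eqVneq (Num.sqrt (r (S z) z)) 0; first by rewrite mulr0.
have np : 0 < Num.sqrt (r (S z) z) by rewrite lt_neqAle eq_sym n0 sqrtr_ge0.
have [w wE w1] := analysis_normalized n0.
rewrite -ler_pdivlMr// mulrC -wE; apply: ge_inf.
  by exists 0 => _ [x _ <-]; exact: N0.
exists (ana w) => //; split=> //; split; first exact: ana_ell2.
move=> x [xT Tx].
exact: (analysis_orth_null krein Wsub Wclosed v_gt0 B_gt0 besselB w xT Tx).
Qed.

Lemma norm_synthesisP z : N (S z) <= nT * Num.sqrt (r (S z) z).
Proof.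
have [n0|n0] := eqVneq (Num.sqrt (r (S z) z)) 0.
  rewrite n0 mulr0; apply: le_trans (T_bound (ana_ell2 z)) _.
  by rewrite (sqrtrM _ (ltW B_gt0)) SE n0 mulr0.
have np : 0 < Num.sqrt (r (S z) z) by rewrite lt_neqAle eq_sym n0 sqrtr_ge0.
have [w wE w1] := analysis_normalized n0.
rewrite -ler_pdivrMr// mulrC -wE; apply: ub_le_sup.
  (* The Bessel bound makes the set bounded above, so that [sup] is a genuine supremum. *)
  exists (Num.sqrt B) => _ [x [xT x1] <-].
  apply: le_trans (T_bound xT) _; rewrite (sqrtrM _ (ltW B_gt0)) -[leRHS]mulr1.
  by rewrite ler_wpM2l ?sqrtr_ge0// -(ell2_norm hip xT).
by exists (ana w) => //; split; [exact: ana_ell2|rewrite w1].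
Qed.

(** The infimum is at least [sqrt c]: a unit [x] orthogonal to the null space is some [T^* y], so
    [1 = <S y, y> <= |T x| |y|] while [c |y|^2 <= 1]. *)
Lemma gamma_synthesis_gt0 (c : R) : 0 < c ->
  (forall x, E2T x -> exists2 y, M y & S y = T x) ->
  (forall y, M y -> c * N y ^+ 2 <= r (S y) y) ->
  (exists2 y, M y & y != 0) -> 0 < gT.
Proof.
move=> c0 Sonto Sc [y0 My0 y00].
have sc0 : 0 < Num.sqrt c by rewrite sqrtr_gt0.
apply: lt_le_trans sc0 _; apply: lb_le_inf.
  have n0 : Num.sqrt (r (S y0) y0) != 0.
    rewrite gt_eqF// sqrtr_gt0; apply: lt_le_trans (Sc _ My0).
    rewrite mulr_gt0// exprn_gt0// lt_neqAle N0 andbT eq_sym.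
    by apply: contra y00 => /eqP /(ipnorm_eq0 hip) ->.
  have [w wE w1] := analysis_normalized n0.
  exists (N (T (ana w))), (ana w) => //; split=> //; split; first exact: ana_ell2.
  move=> x [xT Tx].
  exact: (analysis_orth_null krein Wsub Wclosed v_gt0 B_gt0 besselB w xT Tx).
move=> _ [x [xo x1] <-].
have [y My yx] := Sonto x (proj1 xo).
have xE := null_orth_analysis krein Wsub Wclosed v_gt0 B_gt0 besselB xo (esym yx).
have sx : sqnorm form J x = 1.
  have := ell2_norm hip (proj1 xo); rewrite x1 => E.
  by rewrite -[LHS](sqr_sqrtr (sqnorm_ge0 form J x)) -E expr1n.
have r1 : r (S y) y = 1 by rewrite -sx [in RHS]xE; exact: esym (SE y).
have H1 := rN (S y) y; rewrite r1 normr1 yx in H1.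
have H2 := Sc _ My; rewrite r1 in H2.
have := N0 (T x); move: H1 H2; move: (N (T x)) (N y) => a b ab cb a0.
rewrite -(ger0_norm a0) -sqrtr_sqr; apply: ler_wsqrtr.
have ab2 : 1 <= (a * b) ^+ 2 by rewrite exprn_ege1.
have := ler_wpM2l (ltW c0) ab2; have := ler_wpM2l (sqr_ge0 a) cb.
by rewrite exprMn !mulr1 mulrCA => A C; exact: le_trans C A.
Qed.

(** [G f] is the projection of [J f] onto [M], and projecting onto [M] first changes nothing for
    [W i] inside [M]. *)
Lemma analysis_gramian f : submod_closed [in M] -> ana (G f) = ana (J f).
Proof.
move=> Msub; apply/funext => i; rewrite /analysis /restr; case: asboolP => // Pi.
congr (_ *: _); apply: (orth_proj_unique hip (Wsub i) (@Wclosed i)).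
  exact: (orth_proj_mem hip (Wsub i) (@Wclosed i)).
move=> z Wz; rewrite (orth_proj_Re hip (Wsub i) (@Wclosed i))//.
by rewrite (orth_proj_Re hip Msub (@closed_closure _ _))//; exact: (closed_sum_sub Pi).
Qed.

Variables (e al : R).
Hypotheses (e2 : e * e = 1) (al_gt0 : 0 < al).
Hypothesis Rsub : submod_closed [in Rg].
Hypothesis Rpos : forall f, Rg f -> al * N f ^+ 2 <= e * qform form f.
Hypothesis Rmax : forall W' : set K, submod_closed [in W'] ->
  (forall f, W' f -> al * N f ^+ 2 <= e * qform form f) -> Rg `<=` W' -> W' = Rg.

(** The bounded form [e [., .] - al <., .>] stays nonnegative on the closure of the range, which is
    therefore uniformly definite with the same constant; maximality then forces it to equal the
    range. *)
Lemma range_synthesisE : Rg = M.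
Proof.
rewrite -(closure_range krein P Wsub Wclosed v_gt0 B_gt0 besselB).
apply/esym/Rmax; [exact: (closure_submod hip)| |exact: subset_closure].
pose b x y := e * complex.Re (form x y) - al * r x y.
have sq := sym_form_form form e.
have sb : sym_form b.
  split=> [x y z|t x y|x y]; rewrite /b.
  - by rewrite (sfDl sq) (sfDl sr); ring.
  - by rewrite (sfZl sq) (sfZl sr); ring.
  - by rewrite (sfC sq) (sfC sr).
have bC x y : `|b x y| <= (`|e| + al) * (N x * N y).
  apply: le_trans (ler_normB _ _) _; rewrite !normrM mulrDl (ger0_norm (ltW al_gt0)).
  apply: lerD; apply: ler_wpM2l => //; last exact: ltW.
  exact: (form_bound krein).
have C0 : 0 <= `|e| + al by rewrite addr_ge0// ltW.
have b0 f : Rg f -> 0 <= b f f.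
  by move=> /Rpos; rewrite subr_ge0 (ipnorm_sqr hip).
move=> f fR; rewrite -subr_ge0 (ipnorm_sqr hip).
exact: (closure_form_ge0 hip sb C0 bC b0).
Qed.

Lemma fusion_bounds (c : R) : (exists2 f, M f & f != 0) -> 0 < c ->
  (forall f, M f -> ((c * (e * qform form f))%:E <= frame_sum form J W v P f)%E) ->
  [/\ 0 < gT ^+ 2 * gG ^+ 2, 0 < gG,
    forall f, M f -> ((gT ^+ 2 * gG ^+ 2 * (e * qform form f))%:E
      <= frame_sum form J W v P f)%E
  & forall f, M f -> (frame_sum form J W v P f
      <= (1 / gG * nT ^+ 2 * (e * qform form f))%:E)%E].
Proof.
move=> Mnz c0 cM; have RM := range_synthesisE.
have Msub : submod_closed [in M] by rewrite -RM.
have Mclosed : closed M by exact: closed_closure.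
have Mpos f : M f -> al * N f ^+ 2 <= e * qform form f by rewrite -RM; exact: Rpos.
have FE f : frame_sum form J W v P f = (r (S (G f)) (G f))%:E.
  by rewrite (frame_sumE krein P Wsub Wclosed besselB) -analysis_gramian// SE.
have SM y : M (S y) by rewrite -RM; exists (ana y).
have Sb := frame_op_bounded krein P Wsub Wclosed v_gt0 B_gt0 besselB.
(* [c] comes from the given frame bound and [al] from uniform definiteness; together they bound the
   frame sum below by [|f|^2]. *)
have cal : 0 < c * al by rewrite mulr_gt0.
have Sc f : M f -> c * al * N f ^+ 2 <= r (S (G f)) (G f).
  move=> Mf; have := cM f Mf; rewrite FE lee_fin; apply: le_trans.
  by rewrite -mulrA ler_pM2l//; exact: Mpos.
have co := op_coercive krein Msub Mclosed e2 al_gt0 Mpos cal Sc.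
have onto := op_onto krein Msub Mclosed e2 al_gt0 Mpos SC SM (ltW B_gt0) Sb cal Sc.
have gG0 := gamma_gramian_gt0 krein Msub Mclosed e2 al_gt0 Mpos Mnz.
have gG1 := gamma_gramian_le1 krein Msub Mclosed e2 al_gt0 Mpos Mnz.
have gT0 : 0 < gT.
  apply: (gamma_synthesis_gt0 cal) => // x xT.
  by have [|y My yx] := onto (T x); [rewrite -RM; exists x|exists y].
split=> //.
- by rewrite mulr_gt0// exprn_gt0.
- move=> f Mf; rewrite FE lee_fin.
  have GM := gramian_mem krein Msub Mclosed f.
  have low := op_norm_lower krein Msub Mclosed e2 al_gt0 Mpos SC SM
    (ltW B_gt0) Sb S_ge0 cal Sc (ltW gT0) gamma_synthesisP GM.
  apply: le_trans low.
  rewrite -mulrA ler_wpM2l ?sqr_ge0//.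
  have H := gamma_gramianP krein Msub Mclosed e2 al_gt0 Mpos Mf.
  apply: le_trans (_ : (gG * N f) ^+ 2 <= _).
    by rewrite exprMn ler_wpM2l ?sqr_ge0//; exact: qform_le.
  by rewrite ler_pXn2r ?nnegrE// mulr_ge0// ltW.
- move=> f Mf; rewrite FE lee_fin.
  apply: le_trans (op_norm_upper krein S_ge0 _ norm_synthesisP) _.
  have H := gramian_sqr krein Msub Mclosed e2 al_gt0 Mpos Mf.
  have q0 := le_trans (sqr_ge0 _) H.
  apply: le_trans (ler_wpM2l (sqr_ge0 nT) H) _.
  rewrite -[leRHS]mulrA div1r; apply: ler_peMl; last by rewrite invf_ge1.
  by apply: mulr_ge0 => //; exact: sqr_ge0.
Qed.

End FusionBounds.

(** * The optimal frame bounds *)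

Section Frames.
Context {R : realType} {K : completeNormedModType R[i]}.
Variables (form : {hermitian_sym K for @conjc R}) (J : {linear K -> K}).
Hypothesis krein : krein_space form J.
Context {I : choiceType}.
Variables (W : I -> set K) (v : I -> R).
Let hip := hilbert_J_ip krein.
Local Notation N := (J_norm form J).

Lemma bessel_fin : bessel form J W v -> exists2 B : R, 0 < B &
  forall f (A : {fset I}),
  \sum_(i <- A) v i ^+ 2 * N (J_proj form J (W i) f) ^+ 2 <= B * N f ^+ 2.
Proof.
(* The maximum with 1 makes the bound positive, so that it can be divided by. *)
move=> [B HB]; exists (Num.max B 1); first by rewrite lt_max ltr01 orbT.
move=> f A; have /esum_setT_le/(_ A)/le_trans := HB f; apply.
by rewrite ler_wpM2r ?sqr_ge0// le_max lexx.
Qed.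

Lemma frame_sum0 P : (forall i, submod_closed [in W i]) ->
  (forall i, closed (W i)) -> frame_sum form J W v P 0 = 0%E.
Proof.
move=> Wsub Wcl; apply: esum1 => i _; rewrite linear0r.
by rewrite /= expr0n/= addr0 sqrtr0 mulr0.
Qed.

(** Covers both signs: [e = 1] with [c = Ap], and [e = -1] with [c = - Am]. *)
Lemma fusion_frame_bounds (P : set I) (e : R) (U : set K -> Prop) (c : R) :
  weighted_family form W v -> bessel form J W v -> e * e = 1 ->
  (forall M, U M <-> submod_closed [in M] /\
    exists2 a : R, 0 < a & forall f, M f -> a * N f ^+ 2 <= e * qform form f) ->
  maximal_wrt U (range_synthesis_on form J W v P) ->
  let M := closed_sum W P in
  let gG := gamma_gramian form J M in
  let gT := gamma_synthesis_on form J W v P in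
  let nT := norm_synthesis_on form J W v P in
  (exists2 f, M f & f != 0) -> 0 < c ->
  (forall f, M f -> ((c * (e * qform form f))%:E <= frame_sum form J W v P f)%E) ->
  [/\ 0 < gT ^+ 2 * gG ^+ 2, 0 < 1 / gG * nT ^+ 2,
    forall f, M f -> 0 <= e * qform form f,
    forall f, M f -> ((gT ^+ 2 * gG ^+ 2 * (e * qform form f))%:E
      <= frame_sum form J W v P f)%E
  & forall f, M f -> (frame_sum form J W v P f
      <= (1 / gG * nT ^+ 2 * (e * qform form f))%:E)%E].
Proof.
move=> fam /bessel_fin[B B0 HB] e2 UE [/UE[Rsub [a a0 Ra]] Umax] M gG gT nT Mnz c0 cM.
have Wsub i : submod_closed [in W i] by case: (fam i).
have Wcl i : closed (W i) by case: (fam i).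
have v0 i : 0 < v i by case: (fam i).
have Rmax (W' : set K) : submod_closed [in W'] ->
    (forall f, W' f -> a * N f ^+ 2 <= e * qform form f) ->
    range_synthesis_on form J W v P `<=` W' -> W' = range_synthesis_on form J W v P.
  by move=> W'sub W'a; apply: Umax; apply/UE; split=> //; exists a.
have [H1 gG0 H3 H4] :=
  fusion_bounds krein Wsub Wcl v0 B0 HB e2 a0 Rsub Ra Rmax Mnz c0 cM.
have RM := range_synthesisE krein Wsub Wcl v0 B0 HB a0 Rsub Ra Rmax.
have Ma f : M f -> a * N f ^+ 2 <= e * qform form f by rewrite /M -RM; exact: Ra.
split=> // [|f /Ma]; last by apply: le_trans; rewrite mulr_ge0 ?sqr_ge0 ?ltW.
(* Comparing the given lower bound with the new upper one at a nonzero [f] yields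
   [c <= 1 / gG * nT ^+ 2], whence positivity. *)
have [f Mf f0] := Mnz; have N1 : 0 < N f ^+ 2.
  rewrite exprn_gt0// lt_neqAle sqrtr_ge0 andbT eq_sym.
  by apply: contra f0 => /eqP /(ipnorm_eq0 hip) ->.
have qf : 0 < e * qform form f by apply: lt_le_trans (Ma _ Mf); rewrite mulr_gt0.
have := le_trans (cM f Mf) (H4 f Mf); rewrite lee_fin ler_pM2r//.
exact: lt_le_trans.
Qed.

End Frames.

Theorem theorem2p8 (R : realType) (K : completeNormedModType R[i])
    (form : {hermitian_sym K for @conjc R}) (J : {linear K -> K})
    (I : choiceType) (W : I -> set K) (v : I -> R) (Bm Am Ap Bp : R) :
  krein_space form J ->
  J_fusion_frame form J W v ->
  optimal_J_frame_bounds form J W v Bm Am Ap Bp ->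
  let gGp := gamma_gramian form J (Mplus form W) in
  let gGm := gamma_gramian form J (Mminus form W) in
  let gTp := gamma_synthesis_on form J W v (Iplus form W) in
  let gTm := gamma_synthesis_on form J W v (Iminus form W) in
  let nTp := norm_synthesis_on form J W v (Iplus form W) in
  let nTm := norm_synthesis_on form J W v (Iminus form W) in
  [/\ - (1 / gGm * nTm ^+ 2) <= Bm,
      Bm <= Am,
      Am <= - (gTm ^+ 2 * gGm ^+ 2) &
      - (gTm ^+ 2 * gGm ^+ 2) < 0] /\
  [/\ 0 < gTp ^+ 2 * gGp ^+ 2,
      gTp ^+ 2 * gGp ^+ 2 <= Ap,
      Ap <= Bp &
      Bp <= 1 / gGp * nTp ^+ 2].
Proof.
move=> krein [fam bes maxp maxm] [[[BAm Am0 Ap0 ABp] [bp bm]] opt] gGp gGm gTp gTm nTp nTm.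
have fs0 P : frame_sum form J W v P 0 = 0%E.
  by apply: frame_sum0 => i; case: (fam i).
have q0 : qform form 0 = 0 by rewrite /qform linear0l.
(* If only 0 were available, [Ap + 1] and [Bp + 1] would be admissible too, against the optimality
   of [Ap]. *)
have Mp_nz : exists2 f, Mplus form W f & f != 0.
  apply/not_exists2P => M0.
  have [] : [/\ Ap + 1 <= Ap, `|Am| <= `|Am|, Bp <= Bp + 1 & `|Bm| <= `|Bm|].
    apply: opt; split; first by split=> //; lra.
    split=> // f Mf; have [/(_ Mf)//|/negP/negPn/eqP ->] := M0 f.
    by rewrite fs0 q0 !mulr0.
  lra.
have Mm_nz : exists2 f, Mminus form W f & f != 0.
  apply/not_exists2P => M0.
  have [] : [/\ Ap <= Ap, `|Am - 1| <= `|Am|, Bp <= Bp & `|Bm| <= `|Bm - 1|].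
    apply: opt; split; first by split=> //; lra.
    split=> // f Mf; have [/(_ Mf)//|/negP/negPn/eqP ->] := M0 f.
    by rewrite fs0 q0 !mulr0.
  by rewrite !ltr0_norm; lra.
have Up M : uniformly_J_positive form J M <-> submod_closed [in M] /\
    exists2 a : R, 0 < a & forall f, M f -> a * J_norm form J f ^+ 2 <=
      1 * qform form f.
  by split=> -[Msub [a a0 Ma]]; split=> //; exists a => // f /Ma; rewrite mul1r.
have Um M : uniformly_J_negative form J M <-> submod_closed [in M] /\
    exists2 a : R, 0 < a & forall f, M f -> a * J_norm form J f ^+ 2 <=
      -1 * qform form f.
  by split=> -[Msub [a a0 Ma]]; split=> //; exists a => // f /Ma; rewrite mulN1r.
have cp f : Mplus form W f ->
    ((Ap * (1 * qform form f))%:E <= frame_sum form J W v (Iplus form W) f)%E.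
  by move=> Mf; rewrite mul1r; case: (bp f Mf).
have cm f : Mminus form W f ->
    ((- Am * (-1 * qform form f))%:E <= frame_sum form J W v (Iminus form W) f)%E.
  by move=> Mf; rewrite mulN1r mulrNN; case: (bm f Mf).
have e1 : 1 * 1 = 1 :> R by rewrite mulr1.
have e2 : -1 * -1 = 1 :> R by rewrite mulrNN mulr1.
have Am1 : 0 < - Am by rewrite oppr_gt0.
have [p1 p2 p3 p4 p5] := fusion_frame_bounds krein fam bes e1 Up maxp Mp_nz Ap0 cp.
have [m1 m2 m3 m4 m5] := fusion_frame_bounds krein fam bes e2 Um maxm Mm_nz Am1 cm.
rewrite -/(Mplus form W) -/gGp -/gTp -/nTp in p1 p2 p3 p4 p5.
rewrite -/(Mminus form W) -/gGm -/gTm -/nTm in m1 m2 m3 m4 m5.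
move: p1 p2 p4 p5 m1 m2 m4 m5.
move: (gTp ^+ 2 * gGp ^+ 2) (1 / gGp * nTp ^+ 2) => ap bup.
move: (gTm ^+ 2 * gGm ^+ 2) (1 / gGm * nTm ^+ 2) => am bum.
move=> p1 p2 p4 p5 m1 m2 m4 m5.
(* The quadruple tested must keep its lower constant below its upper one, hence the maximum with
   [Bp]; enlarging the upper constant is harmless as [qform] is nonnegative on [Mplus]. *)
have Hap : ap <= Ap.
  have [] // : [/\ ap <= Ap, `|Am| <= `|Am|, Bp <= Num.max Bp ap & `|Bm| <= `|Bm|].
  apply: opt; split; first by split=> //; rewrite le_max lexx orbT.
  split=> // f Mf; have := p4 f Mf; have := p3 f Mf; rewrite mul1r => qf ->; split=> //.
  apply: le_trans (proj2 (bp f Mf)) _.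
  by rewrite lee_fin ler_wpM2r// le_max lexx.
have Hbp : Bp <= bup.
  have [] // : [/\ Num.min Ap bup <= Ap, `|Am| <= `|Am|, Bp <= bup & `|Bm| <= `|Bm|].
  apply: opt; split; first by split=> //; rewrite ?lt_min ?Ap0// ge_min lexx orbT.
  split=> // f Mf; have := p5 f Mf; have := p3 f Mf; rewrite mul1r => qf ->; split=> //.
  apply: le_trans (proj1 (bp f Mf)).
  by rewrite lee_fin ler_wpM2r// ge_min lexx.
(* On the negative side the order is reversed: [- am] is tried in place of [Am], and [Bm] is lowered
   where necessary. *)
have Ham : am <= - Am.
  have [_] : [/\ Ap <= Ap, `|- am| <= `|Am|, Bp <= Bp & `|Bm| <= `|Num.min Bm (- am)|].
    apply: opt; split; first by split=> //; rewrite ?oppr_lt0// ge_min lexx orbT.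
    split=> // f Mf; have := m4 f Mf; have := m3 f Mf.
    rewrite mulN1r oppr_ge0 mulrN -mulNr => qf ->; split=> //.
    apply: le_trans (proj2 (bm f Mf)) _.
    by rewrite lee_fin ler_wnM2r// ge_min lexx.
  by rewrite normrN gtr0_norm// ltr0_norm.
have Hbm : - bum <= Bm.
  have [_ _ _] : [/\ Ap <= Ap, `|Num.max Am (- bum)| <= `|Am|, Bp <= Bp & `|Bm| <= `|- bum|].
    apply: opt; split; first by split=> //; rewrite ?gt_max ?Am0 ?oppr_lt0// le_max lexx orbT.
    split=> // f Mf; have := m5 f Mf; have := m3 f Mf.
    rewrite mulN1r oppr_ge0 mulrN -mulNr => qf ->; split=> //.
    apply: le_trans (proj1 (bm f Mf)).
    by rewrite lee_fin ler_wnM2r// le_max lexx.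
  by rewrite normrN (gtr0_norm m2) (ltr0_norm (le_lt_trans BAm Am0)) lerNl.
by split; split=> //; rewrite ?oppr_lt0// lerNr.
Qed.
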